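(* Let $(M,g)$ be a co-screen (proper) QGCR-lightlike submanifold of an indefinite nearly $\mu$-Sasakian manifold $(\overline{M},\overline{\phi},\xi,\eta,\overline{g})$, with decomposition $TM=D\oplus\overline{D}$. If $\overline{D}$ is nearly auto-parallel, then for all $X,Y\in\Gamma(\overline{D})$ the vector field $A_{\varphi_1X}Y+A_{\overline{\phi}Y}X$ has no component in $D$.
   Context: Ambient manifold. An indefinite almost contact metric manifold $(\overline{M},\overline{\phi},\xi,\eta,\overline{g})$ is an odd-dimensional manifold with a $(1,1)$-tensor $\overline{\phi}$, a vector field $\xi$, a 1-form $\eta$ and a semi-Riemannian metric $\overline{g}$ with $\overline{\phi}^2=-\mathbb{I}+\eta\otimes\xi$, $\eta(\xi)=1$, $\eta\circ\overline{\phi}=0$, $\overline{\phi}\xi=0$, $\overline{g}(\overline{\phi}X,\overline{\phi}Y)=\overline{g}(X,Y)-\eta(X)\eta(Y)$, $\eta(X)=\overline{g}(\xi,X)$. With $\overline{\nabla}$ the Levi-Civita connection of $\overline{g}$ and $\mu$ a real constant, it is indefinite nearly $\mu$-Sasakian if $(\overline{\nabla}_X\overline{\phi})Y+(\overline{\nabla}_Y\overline{\phi})X=\mu\{2\overline{g}(X,Y)\xi-\eta(Y)X-\eta(X)Y\}$ for all vector fields $X,Y$ on $\overline{M}$. Lightlike submanifolds. $M$ is a submanifold of $\overline{M}$ with induced (degenerate) metric $g$ such that $\mathrm{Rad}\,TM=TM\cap TM^\perp$ is a smooth distribution of rank $r>0$. $S(TM)$ is a chosen non-degenerate complement of $\mathrm{Rad}\,TM$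 in $TM$, and $S(TM^\perp)$ a chosen non-degenerate complement of $\mathrm{Rad}\,TM$ in $TM^\perp$. For a local basis $\{E_i\}$ of $\mathrm{Rad}\,TM$ there are local sections $\{N_i\}$ of the orthogonal complement of $S(TM^\perp)$ in $S(TM)^\perp$ with $\overline{g}(E_i,N_j)=\delta_{ij}$, $\overline{g}(N_i,N_j)=0$; they span the lightlike transversal bundle $l\mathrm{tr}(TM)$. Put $\mathrm{tr}(TM)=l\mathrm{tr}(TM)\perp S(TM^\perp)$, so $T\overline{M}|_M=TM\oplus\mathrm{tr}(TM)$. For $X,Y\in\Gamma(TM)$ and $V\in\Gamma(\mathrm{tr}(TM))$ write $\overline{\nabla}_XY=\nabla_XY+h(X,Y)$ and $\overline{\nabla}_XV=-A_VX+\nabla^t_XV$, with $\nabla_XY,A_VX\in\Gamma(TM)$ and $h(X,Y),\nabla^t_XV\in\Gamma(\mathrm{tr}(TM))$. QGCR-lightlike. $(M,g,S(TM),S(TM^\perp))$ is quasi generalized CR (QGCR)-lightlike if: (i) there are distributions $D_1,D_2$ of $\mathrm{Rad}\,TM$ with $\mathrm{Rad}\,TM=D_1\oplus D_2$, $\overline{\phi}D_1=D_1$, $\overline{\phi}D_2\subset S(TM)$; (ii) there are vector subbundles $D_0,\overline{D}$ of $S(TM)$ with $S(TM)=\{\overline{\phi}D_2\oplus\overline{D}\}\perp D_0$, $\overline{\phi}D_0\subseteq D_0$, $\overline{D}=\overline{\phi}\mathcal{S}\oplus\overline{\phi}\mathcal{L}$, where $D_0$ is non-degenerate and $\mathcal{L}$,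 $\mathcal{S}$ are vector subbundles of $l\mathrm{tr}(TM)$ and $S(TM^\perp)$ respectively. It is proper if $D_1,D_0,D_2,\mathcal{S}$ are all nonzero; QGCR-lightlike submanifolds are assumed proper. Co-screen: $\xi\in\Gamma(S(TM^\perp))$ along $M$. In this case $TM=D\oplus\overline{D}$ with $D=\mathrm{Rad}\,TM\perp D_0\perp\overline{\phi}D_2$, $\overline{\phi}\,\overline{D}=\mathcal{S}\perp\mathcal{L}$, and $\mathrm{tr}(TM)=\overline{\phi}\,\overline{D}\perp\mathcal{G}\perp\mathbb{R}\xi$ with $\overline{\phi}\mathcal{G}=\mathcal{G}$. ''No component in $D$'' means zero projection onto $D$ along $\overline{D}$. For $X\in\Gamma(TM)$ write $\overline{\phi}X=\phi_1X+\varphi_1X$ with $\phi_1X\in\Gamma(TM)$, $\varphi_1X\in\Gamma(\mathrm{tr}(TM))$. A distribution $\mathcal{D}$ on $M$ is nearly auto-parallel if $\nabla_XY+\nabla_YX\in\Gamma(\mathcal{D})$ for all $X,Y\in\Gamma(\mathcal{D})$. *)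

(* Defs.v *)
From HB Require Import structures.
From mathcomp Require Import all_boot all_order all_algebra.
From mathcomp Require Import all_classical all_reals all_analysis.

Set Implicit Arguments.
Unset Strict Implicit.
Unset Printing Implicit Defensive.

Import Order.TTheory GRing.Theory Num.Theory.
Import numFieldNormedType.Exports.

Local Open Scope classical_set_scope.
Local Open Scope ring_scope.

(* ** Smooth maps between open sets of normed spaces *)

Section SmoothMaps.
Context {R : realType}.

(* Only meaningful when A is open. *)
Fixpoint Ck (V W : normedModType R) (k : nat) (A : set V) (f : V -> W) : Prop :=
  match k with
  | 0 => forall x, A x -> {for x, continuous f}
  | k'.+1 => (forall x, A x -> differentiable f x) /\
             (forall v : V, Ck k' A (fun x => 'D_v f x))
  end.

Definition Cinfty (V W : normedModType R) (A : set V) (f : V -> W) : Prop :=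
  forall k, Ck k A f.

End SmoothMaps.

(* ** Smooth manifolds *)

(* cinv is a total function whose values off the image of the domain are
   irrelevant. *)
Record chart (R : realType) (n : nat) (T : topologicalType) := Chart {
  dom : set T;
  cmap : T -> 'rV[R]_n;
  cinv : 'rV[R]_n -> T;
  dom_open : open dom;
  im_open : open (cmap @` dom);
  cmapK : forall x, dom x -> cinv (cmap x) = x;
  cmap_continuous : forall x, dom x -> {for x, continuous cmap};
  cinv_continuous : forall y, (cmap @` dom) y -> {for y, continuous cinv}
}.

(* The tangent space at p is modelled by 'rV_n: a row vector stands for the
   tangent vector at p having these components in the preferred chart
   chart_at p.  Components in the other charts are given by chart_coord below. *)
Record manifold (R : realType) (n : nat) := Manifold {
  mpoint :> topologicalType;
  mhausdorff : hausdorff_space mpoint;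
  msecond_countable : @second_countable mpoint;
  mindex : Type;
  atlas : mindex -> chart R n mpoint;
  atlas_smooth : forall c c' : mindex,
    Cinfty (cmap (atlas c) @` (dom (atlas c) `&` dom (atlas c')))
           (cmap (atlas c') \o cinv (atlas c));
  chart_at : mpoint -> mindex;
  chart_atP : forall p, dom (atlas (chart_at p)) p
}.

Section Calculus.
Context {R : realType}.

Definition vfield (n : nat) (M : manifold R n) := M -> 'rV[R]_n.

Definition smooth_on (n : nat) (M : manifold R n) (E : normedModType R)
    (U : set M) (f : M -> E) : Prop :=
  forall c : mindex M,
    Cinfty (cmap (atlas c) @` (dom (atlas c) `&` U)) (f \o cinv (atlas c)).

(* v(f), the derivative of f at p along the tangent vector v *)
Definition dirder (n : nat) (M : manifold R n) (E : normedModType R)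
    (f : M -> E) (p : M) (v : 'rV[R]_n) : E :=
  'd (f \o cinv (atlas (chart_at p))) (cmap (atlas (chart_at p)) p) v.

(* components in the chart c of the tangent vector v at p *)
Definition chart_coord (n : nat) (M : manifold R n) (c : mindex M) (p : M)
    (v : 'rV[R]_n) : 'rV[R]_n :=
  dirder (cmap (atlas c)) p v.

(* the coordinate vector field d/dx^a of the chart c *)
Definition cframe (n : nat) (M : manifold R n) (c : mindex M) (a : 'I_n) :
    vfield M :=
  fun p => 'd (cmap (atlas (chart_at p)) \o cinv (atlas c)) (cmap (atlas c) p)
              (delta_mx 0 a).

Definition smooth_map (m n : nat) (M : manifold R m) (N : manifold R n)
    (i : M -> N) : Prop :=
  continuous i /\
  forall c : mindex N, smooth_on (i @^-1` dom (atlas c)) (cmap (atlas c) \o i).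

(* the differential of i at p *)
Definition tmap (m n : nat) (M : manifold R m) (N : manifold R n)
    (i : M -> N) (p : M) (v : 'rV[R]_m) : 'rV[R]_n :=
  dirder (cmap (atlas (chart_at (i p))) \o i) p v.

Definition immersion (m n : nat) (M : manifold R m) (N : manifold R n)
    (i : M -> N) : Prop :=
  smooth_map i /\ forall p : M, injective (tmap i p).

(* the image of T_pM in T_{i(p)}N *)
Definition tspace (m n : nat) (M : manifold R m) (N : manifold R n)
    (i : M -> N) (p : M) : {vspace 'rV[R]_n} :=
  limg (linfun (tmap i p)).

(* smoothness over U of a section V of the pullback i^*TN *)
Definition smooth_along (m n : nat) (M : manifold R m) (N : manifold R n)
    (i : M -> N) (U : set M) (V : M -> 'rV[R]_n) : Prop :=
  forall c : mindex N,
    smooth_on (U `&` i @^-1` dom (atlas c)) (fun p => chart_coord c (i p) (V p)).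

Definition smooth_vfield (n : nat) (M : manifold R n) (X : vfield M) : Prop :=
  smooth_along (fun p : M => p) setT X.

Definition smooth_fun (n : nat) (M : manifold R n) (f : M -> R^o) : Prop :=
  smooth_on setT f.

(* E is a smooth subbundle of rank k of the pullback i^*TN *)
Definition subbundle_rank (m n : nat) (M : manifold R m) (N : manifold R n)
    (i : M -> N) (k : nat) (E : M -> {vspace 'rV[R]_n}) : Prop :=
  forall p0 : M, exists (U : set M) (s : 'I_k -> M -> 'rV[R]_n),
    [/\ open U, U p0, (forall j, smooth_along i U (s j))
      & forall p, U p -> basis_of (E p) [tuple s j p | j < k]].

Definition subbundle (m n : nat) (M : manifold R m) (N : manifold R n)
    (i : M -> N) (E : M -> {vspace 'rV[R]_n}) : Prop :=
  exists k, subbundle_rank i k E.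

(* X is a smooth vector field on M with values in E, a subbundle of TM seen
   inside i^*TN *)
Definition tsection (m n : nat) (M : manifold R m) (N : manifold R n)
    (i : M -> N) (E : M -> {vspace 'rV[R]_n}) (X : vfield M) : Prop :=
  smooth_vfield X /\ forall p, tmap i p (X p) \in E p.

End Calculus.

(* ** Symmetric bilinear forms *)

Section Forms.
Context {R : realType} {n : nat}.
Implicit Types (B : 'Hom('rV[R]_n, 'Hom('rV[R]_n, R^o)))
  (U V W : {vspace 'rV[R]_n}).

Definition orth B U V : Prop :=
  forall u v, u \in U -> v \in V -> B u v = 0.

Definition nondeg_on B U : Prop :=
  forall u, u \in U -> (forall v, v \in U -> B u v = 0) -> u = 0.

Definition negdef_on B U : Prop :=
  forall u, u \in U -> u != 0 -> B u u < 0.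

Definition orthv B U : {vspace 'rV[R]_n} :=
  (\bigcap_(u <- vbasis U) lker (B u))%VS.

Lemma memv_orthv B U v :
  reflect (forall u, u \in U -> B u v = 0) (v \in orthv B U).
Proof.
apply: (iffP idP) => [vU u uU|H].
  rewrite (coord_vbasis uU) linear_sum sum_lfunE big1 // => j _.
  rewrite linearZ lfunE /=.
  suff -> : B (vbasis U)`_j v = 0 by rewrite scaler0.
  apply/eqP; rewrite -memv_ker; apply: subvP vU; rewrite /orthv.
  have jU : (vbasis U)`_j \in tval (vbasis U) by rewrite mem_nth // size_tuple.
  by rewrite (big_rem _ jU) /= capvSl.
rewrite /orthv memvE big_seq.
elim/big_rec: _ => [|u W uU IH]; first exact: subvf.
by rewrite subv_cap IH andbT -memvE memv_ker H // vbasis_mem.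
Qed.

End Forms.

(* ** Ambient structure *)

Section Connections.
Context {R : realType}.

(* D is a connection on the pullback bundle i^*TN, as an operator on smooth
   sections; its values on non-smooth arguments are irrelevant.  For i the
   identity this is an affine connection on M. *)
Record connection_along (m n : nat) (M : manifold R m) (N : manifold R n)
    (i : M -> N)
    (D : vfield M -> (M -> 'rV[R]_n) -> (M -> 'rV[R]_n)) : Prop := {
  conn_smooth : forall X V, smooth_vfield X -> smooth_along i setT V ->
    smooth_along i setT (D X V);
  conn_addl : forall X X' V, smooth_vfield X -> smooth_vfield X' ->
    smooth_along i setT V ->
    forall p, D (fun q => X q + X' q) V p = D X V p + D X' V p;
  conn_scalel : forall (f : M -> R^o) X V, smooth_fun f -> smooth_vfield X ->
    smooth_along i setT V ->
    forall p, D (fun q => f q *: X q) V p = f p *: D X V p;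
  conn_addr : forall X V V', smooth_vfield X -> smooth_along i setT V ->
    smooth_along i setT V' ->
    forall p, D X (fun q => V q + V' q) p = D X V p + D X V' p;
  conn_leibniz : forall (f : M -> R^o) X V, smooth_fun f -> smooth_vfield X ->
    smooth_along i setT V ->
    forall p, D X (fun q => f q *: V q) p =
              (dirder f p (X p) : R) *: V p + f p *: D X V p
}.

Definition affine_connection (n : nat) (N : manifold R n)
    (nab : vfield N -> vfield N -> vfield N) : Prop :=
  connection_along (fun p : N => p) nab.

(* The connection induced along i by nab: the value of D X (Z \o i) at p is
   nab_{di(X)} Z, computed with any extension Xt of the vector di(X p). *)
Definition induced_connection (m n : nat) (M : manifold R m) (N : manifold R n)
    (i : M -> N) (nab : vfield N -> vfield N -> vfield N)
    (D : vfield M -> (M -> 'rV[R]_n) -> (M -> 'rV[R]_n)) : Prop :=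
  connection_along i D /\
  forall (X : vfield M) (Xt Z : vfield N) (p : M),
    smooth_vfield X -> smooth_vfield Xt -> smooth_vfield Z ->
    Xt (i p) = tmap i p (X p) ->
    D X (Z \o i) p = nab Xt Z (i p).

Definition tensor2 (n : nat) (N : manifold R n) :=
  N -> 'Hom('rV[R]_n, 'Hom('rV[R]_n, R^o)).

Record semi_riemannian (n : nat) (N : manifold R n) (g : tensor2 N) : Prop := {
  metric_smooth : forall (c : mindex N) (a b : 'I_n),
    smooth_on (dom (atlas c))
      (fun q => g q (cframe c a q) (cframe c b q) : R^o);
  metric_sym : forall q u v, g q u v = g q v u;
  metric_nondeg : forall q, nondeg_on (g q) fullv;
  metric_index : exists nu : nat, forall q,
    (exists2 W, \dim W = nu & negdef_on (g q) W) /\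
    (forall W, negdef_on (g q) W -> (\dim W <= nu)%N)
}.

(* Torsion-freeness is expressed by the action of [X, Y] on functions. *)
Record levi_civita (n : nat) (N : manifold R n) (g : tensor2 N)
    (nab : vfield N -> vfield N -> vfield N) : Prop := {
  lc_connection : affine_connection nab;
  lc_torsion_free : forall X Y (f : N -> R^o),
    smooth_vfield X -> smooth_vfield Y -> smooth_fun f ->
    forall q, dirder f q (nab X Y q - nab Y X q) =
      dirder (fun z => dirder f z (Y z)) q (X q)
      - dirder (fun z => dirder f z (X z)) q (Y q);
  lc_metric : forall X Y Z,
    smooth_vfield X -> smooth_vfield Y -> smooth_vfield Z ->
    forall q, dirder (fun z => g z (Y z) (Z z) : R^o) q (X q) =
      g q (nab X Y q) (Z q) + g q (Y q) (nab X Z q)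
}.

Record almost_contact_metric (n : nat) (N : manifold R n)
    (phi : N -> 'End('rV[R]_n)) (xi : vfield N)
    (eta : N -> 'Hom('rV[R]_n, R^o)) (g : tensor2 N) : Prop := {
  acm_odd : odd n;
  acm_metric : semi_riemannian g;
  acm_phi_smooth : forall (c : mindex N) (a : 'I_n),
    smooth_along (fun q : N => q) (dom (atlas c)) (fun q => phi q (cframe c a q));
  acm_xi_smooth : smooth_vfield xi;
  acm_eta_smooth : forall (c : mindex N) (a : 'I_n),
    smooth_on (dom (atlas c)) (fun q => eta q (cframe c a q) : R^o);
  acm_phi2 : forall q u, phi q (phi q u) = - u + (eta q u : R) *: xi q;
  acm_eta_xi : forall q, eta q (xi q) = 1;
  acm_eta_phi : forall q u, eta q (phi q u) = 0;
  acm_phi_xi : forall q, phi q (xi q) = 0;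
  acm_compat : forall q u v,
    g q (phi q u) (phi q v) = g q u v - eta q u * eta q v;
  acm_eta : forall q u, eta q u = g q (xi q) u
}.

(* (nab_X phi) Y *)
Definition covd_phi (n : nat) (N : manifold R n)
    (nab : vfield N -> vfield N -> vfield N) (phi : N -> 'End('rV[R]_n))
    (X Y : vfield N) : vfield N :=
  fun q => nab X (fun z => phi z (Y z)) q - phi q (nab X Y q).

Definition nearly_sasakian (n : nat) (N : manifold R n) (mu : R)
    (phi : N -> 'End('rV[R]_n)) (xi : vfield N)
    (eta : N -> 'Hom('rV[R]_n, R^o)) (g : tensor2 N)
    (nab : vfield N -> vfield N -> vfield N) : Prop :=
  forall X Y : vfield N, smooth_vfield X -> smooth_vfield Y -> forall q,
    covd_phi nab phi X Y q + covd_phi nab phi Y X q =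
    mu *: ((2 * g q (X q) (Y q) : R) *: xi q
           - (eta q (Y q) : R) *: X q - (eta q (X q) : R) *: Y q).

End Connections.

(* ** Lightlike submanifolds

   All bundles along M, including the subbundles of TM, are families of
   subspaces of the tangent spaces of N at the points i p. *)

Section Lightlike.
Context {R : realType} {m n : nat} {M : manifold R m} {N : manifold R n}.
Variables (i : M -> N) (g : tensor2 N).

Let bundle := M -> {vspace 'rV[R]_n}.

Definition direct_sum (W U V : {vspace 'rV[R]_n}) : Prop :=
  W = (U + V)%VS /\ directv (U + V).

(* TM^perp *)
Definition normal_space (p : M) : {vspace 'rV[R]_n} :=
  orthv (g (i p)) (tspace i p).

Definition Rad (p : M) : {vspace 'rV[R]_n} :=
  (tspace i p :&: normal_space p)%VS.

(* STM, STP and ltr are S(TM), S(TM^perp) and ltr(TM). *)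
Record lightlike_submanifold (r : nat) (STM STP ltr : bundle) : Prop := {
  ll_immersion : immersion i;
  ll_rank_gt0 : (0 < r)%N;
  ll_Rad : subbundle_rank i r Rad;
  ll_STM : subbundle i STM;
  ll_STM_compl : forall p, direct_sum (tspace i p) (Rad p) (STM p);
  ll_STM_nondeg : forall p, nondeg_on (g (i p)) (STM p);
  ll_STP : subbundle i STP;
  ll_STP_compl : forall p, direct_sum (normal_space p) (Rad p) (STP p);
  ll_STP_nondeg : forall p, nondeg_on (g (i p)) (STP p);
  ll_ltr : forall p0 : M,
    exists (U : set M) (E L : 'I_r -> M -> 'rV[R]_n),
    [/\ open U, U p0,
        forall j, smooth_along i U (E j) /\ smooth_along i U (L j)
      & forall p, U p ->
        [/\ basis_of (Rad p) [tuple E j p | j < r],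
            ltr p = <<[tuple L j p | j < r]>>%VS,
            forall j, L j p \in
              (orthv (g (i p)) (STP p) :&: orthv (g (i p)) (STM p))%VS,
            forall j k, g (i p) (E j p) (L k p) = (j == k)%:R
          & forall j k, g (i p) (L j p) (L k p) = 0]]
}.

Definition tr (STP ltr : bundle) : bundle := fun p => (ltr p + STP p)%VS.

Variable phi : N -> 'End('rV[R]_n).

(* phibar E *)
Definition phiim (E : bundle) : bundle := fun p => (phi (i p) @: E p)%VS.

(* Proper QGCR-lightlike; S and L are the bundles written \mathcal S and
   \mathcal L, and Db is \overline D. *)
Record proper_QGCR (STM STP ltr D1 D2 D0 Db S L : bundle) : Prop := {
  qgcr_D1 : subbundle i D1;
  qgcr_D2 : subbundle i D2;
  qgcr_Rad : forall p, direct_sum (Rad p) (D1 p) (D2 p);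
  qgcr_phiD1 : forall p, phiim D1 p = D1 p;
  qgcr_phiD2 : forall p, (phiim D2 p <= STM p)%VS;
  qgcr_D0 : subbundle i D0;
  qgcr_Db : subbundle i Db;
  qgcr_STM : forall p, STM p = (phiim D2 p + Db p + D0 p)%VS;
  qgcr_STM_direct : forall p, directv (phiim D2 p + Db p + D0 p);
  qgcr_STM_orth : forall p, orth (g (i p)) (phiim D2 p + Db p)%VS (D0 p);
  qgcr_phiD0 : forall p, (phiim D0 p <= D0 p)%VS;
  qgcr_D0_nondeg : forall p, nondeg_on (g (i p)) (D0 p);
  qgcr_S : subbundle i S;
  qgcr_S_sub : forall p, (S p <= STP p)%VS;
  qgcr_L : subbundle i L;
  qgcr_L_sub : forall p, (L p <= ltr p)%VS;
  qgcr_Db_sum : forall p, direct_sum (Db p) (phiim S p) (phiim L p);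
  qgcr_D1_neq0 : forall p, (D1 p != 0)%VS;
  qgcr_D0_neq0 : forall p, (D0 p != 0)%VS;
  qgcr_D2_neq0 : forall p, (D2 p != 0)%VS;
  qgcr_S_neq0 : forall p, (S p != 0)%VS
}.

(* The characteristic vector field is a section of S(TM^perp), with the
   ensuing splitting of tr(TM); G is \mathcal G. *)
Record co_screen (xi : vfield N) (STP ltr Db S L G : bundle) : Prop := {
  cs_xi : forall p, xi (i p) \in STP p;
  cs_phiDb : forall p, direct_sum (phiim Db p) (S p) (L p);
  cs_phiDb_orth : forall p, orth (g (i p)) (S p) (L p);
  cs_G : subbundle i G;
  cs_tr : forall p, tr STP ltr p = (phiim Db p + G p + <[xi (i p)]>)%VS;
  cs_tr_direct : forall p, directv (phiim Db p + G p + <[xi (i p)]>);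
  cs_orth1 : forall p, orth (g (i p)) (phiim Db p) (G p);
  cs_orth2 : forall p, orth (g (i p)) (phiim Db p + G p)%VS <[xi (i p)]>%VS;
  cs_phiG : forall p, phiim G p = G p
}.

(* D = Rad TM + D0 + phibar D2 *)
Definition Dbundle (D0 D2 : bundle) : bundle :=
  fun p => (Rad p + D0 p + phiim D2 p)%VS.

(* daddv_pi U V is the projection onto U along V. *)
Section GaussWeingarten.
Variables (D : vfield M -> (M -> 'rV[R]_n) -> (M -> 'rV[R]_n)) (trM : bundle).

(* nabla_X Y, as a vector tangent to N *)
Definition nabla (X Y : vfield M) : M -> 'rV[R]_n := fun p =>
  daddv_pi (tspace i p) (trM p) (D X (fun q => tmap i q (Y q)) p).

(* A_V X, as a vector tangent to N *)
Definition shape_op (V : M -> 'rV[R]_n) (X : vfield M) : M -> 'rV[R]_n := fun p =>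
  - daddv_pi (tspace i p) (trM p) (D X V p).

Definition nearly_auto_parallel (E : bundle) : Prop :=
  forall X Y : vfield M, tsection i E X -> tsection i E Y ->
  forall p, nabla X Y p + nabla Y X p \in E p.

End GaussWeingarten.

(* phibar X along M *)
Definition phi_along (X : vfield M) : M -> 'rV[R]_n :=
  fun p => phi (i p) (tmap i p (X p)).

(* the component of phibar X in tr(TM) *)
Definition varphi1 (trM : bundle) (X : vfield M) : M -> 'rV[R]_n :=
  fun p => daddv_pi (trM p) (tspace i p) (phi_along X p).

Definition no_component (E F : bundle) (W : M -> 'rV[R]_n) : Prop :=
  forall p, daddv_pi (E p) (F p) (W p) = 0.

End Lightlike.

(* Main.v *)
Require Import Defs.
From HB Require Import structures.
From mathcomp Require Import all_boot all_order all_algebra.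
From mathcomp Require Import all_classical all_reals all_analysis.
From mathcomp Require Import ring zify.

Set Implicit Arguments.
Unset Strict Implicit.
Unset Printing Implicit Defensive.

Import Order.TTheory GRing.Theory Num.Theory.
Import numFieldNormedType.Exports.

Local Open Scope classical_set_scope.
Local Open Scope ring_scope.

(** For sections [X], [Y] of [Db] both [phi X] and [phi Y] are transversal, so the
    vector in question is minus the tangential part of
    [D_Y (phi X) + D_X (phi Y)].  The nearly Sasakian identity turns this sum into a
    multiple of [xi] plus [phi (D_X Y + D_Y X)]: here [phi] sends the tangential part
    of [D_X Y + D_Y X], which lies in [Db] by near auto-parallelism, into
    [tr(TM)], and it sends [tr(TM) = phi Db + G + <xi>] into [Db + tr(TM)].  Hence
    the tangential part lies in [Db].

    The identity is a hypothesis on global vector fields of [N], whereas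
    [di(X)], [di(Y)] are only sections along [i].  It transfers because
    [V |-> D_X (phi V) - phi (D_X V)] is tensorial, and tensoriality at a point
    needs only smooth bump functions, built from [exp(-1/t)]. *)

(** * Functions of class C^k *)

Section CkCalculus.
Context {R : realType}.
Implicit Types V W E : normedModType R.

(** The first-order expansion of [f] at [x] only involves values near [x], so it is also one of [g];
    uniqueness of the differential then identifies ['d g x] with ['d f x]. *)
Lemma near_eq_differentiable V W (f g : V -> W) (x : V) :
  (\near x, f x = g x) -> differentiable f x -> differentiable g x.
Proof.
move=> fg df.
have gx : g x = f x by rewrite (nbhs_singleton fg).
have dg : g \o shift x = cst (g x) + 'd f x +o_ 0 id.
  apply/eqaddoP => e e0.
  have /eqaddoP/(_ e e0) := diff_locally df.
  rewrite gx.
  have fg0 : \forall h \near (0 : V), f (h + x) = g (h + x).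
    by have := fg; rewrite (near_shift 0) /= ; apply: filterS => h /=; rewrite subr0.
  move=> dfx; near=> h.
  rewrite /= !fctE /=.
  have <- : f (h + x) = g (h + x) by near: h.
  by near: h; exact: dfx.
apply/diff_locallyP; have cd := diff_continuous df.
by rewrite (diff_unique cd dg).
Unshelve. all: by end_near. Qed.

Lemma near_eq_diff V W (f g : V -> W) (x v : V) :
  (\near x, f x = g x) -> differentiable f x -> 'd f x v = 'd g x v.
Proof.
move=> fg df; have dg := near_eq_differentiable fg df.
by rewrite -!deriveE //; exact: near_eq_derive.
Qed.

Lemma Ck_sub V W k (A B : set V) (f : V -> W) :
  B `<=` A -> Ck k A f -> Ck k B f.
Proof.
move=> BA; elim: k f => [|k IH] f /=; first by move=> H x /BA/H.
by case=> H1 H2; split=> [x /BA/H1//|v]; exact: IH.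
Qed.

(** Openness of [A] turns equality on [A] into equality near each of its points, which is what
    limits and derivatives see. *)
Lemma Ck_eq V W k (A : set V) (f g : V -> W) :
  open A -> (forall x, A x -> f x = g x) -> Ck k A f -> Ck k A g.
Proof.
move=> oA; elim: k f g => [|k IH] f g fg /=.
  move=> H x Ax; have nfg : \near x, f x = g x.
    by apply: filterS (open_nbhs_nbhs (conj oA Ax)) => y; exact: fg.
  have := H x Ax; rewrite /prop_for /continuous_at (fg _ Ax).
  by apply: cvg_trans; exact: near_eq_cvg.
have nfg x : A x -> \near x, f x = g x.
  by move=> Ax; apply: filterS (open_nbhs_nbhs (conj oA Ax)) => y; exact: fg.
case=> H1 H2; split=> [x Ax|v].
  exact: near_eq_differentiable (nfg _ Ax) (H1 _ Ax).
apply: IH (H2 v) => x Ax.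
exact: near_eq_derive (nfg _ Ax).
Qed.

(** [Ck k B f] asks for continuity or differentiability in the whole space at each point of [B], so
    it is a pointwise condition and the sets [B] may be arbitrary. *)
Lemma Ck_local V W k (A : set V) (f : V -> W) :
  (forall x, A x -> exists2 B, B x & Ck k B f) -> Ck k A f.
Proof.
elim: k f => [|k IH] f H /=.
  by move=> x /H [B Bx HB]; exact: HB.
split=> [x /H [B Bx [HB _]]|v]; first exact: HB.
apply: IH => x /H [B Bx [_ HB]]; exists B => //; exact: HB.
Qed.

Lemma CkW V W k (A : set V) (f : V -> W) : Ck k.+1 A f -> Ck k A f.
Proof.
elim: k f => [|k IH] f /=.
  by case=> H _ x Ax; exact: differentiable_continuous (H x Ax).
by case=> H1 H2; split=> // v; exact/IH/H2.
Qed.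

Lemma Ck_cst V W k (A : set V) (c : W) : Ck k A (cst c : V -> W).
Proof.
elim: k c => [|k IH] c /=; first by move=> x _; exact: cst_continuous.
split=> // v; under eq_fun do rewrite derive_cst.
exact: IH.
Qed.

Lemma Ck_lin V W E k (A : set V) (f : V -> W) (l : {linear W -> E}) :
  open A -> continuous l -> Ck k A f -> Ck k A (l \o f).
Proof.
move=> oA cl; elim: k f => [|k IH] f /=.
  by move=> H x Ax; apply: continuous_comp; [exact: H|exact: cl].
case=> H1 H2; split=> [x Ax|v].
  apply: differentiable_comp; first exact: H1.
  exact: linear_differentiable.
apply: (@Ck_eq _ _ _ _ (l \o (fun x => 'D_v f x))) => // [x Ax|]; last exact: IH.
have dl : differentiable l (f x) by exact: linear_differentiable.
have df := H1 _ Ax; rewrite [RHS]deriveE; last exact: differentiable_comp.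
by rewrite diff_comp //= diff_lin // deriveE.
Qed.

Lemma Ck_id V k (A : set V) : Ck k A (@id V).
Proof.
case: k => [|k] /=; first by move=> x _; exact: cvg_id.
split=> // v; under eq_fun do rewrite derive_id.
exact: Ck_cst.
Qed.

Lemma Ck_add V W k (A : set V) (f g : V -> W) :
  open A -> Ck k A f -> Ck k A g -> Ck k A (fun x => f x + g x).
Proof.
move=> oA; elim: k f g => [|k IH] f g /=.
  by move=> Hf Hg x Ax; apply: continuousD; [exact: Hf|exact: Hg].
case=> f1 f2 [g1 g2]; split=> [x Ax|v].
  by apply: differentiableD; [exact: f1|exact: g1].
apply: (@Ck_eq _ _ _ _ (fun x => 'D_v f x + 'D_v g x)) => // [x Ax|]; last exact: IH.
by rewrite deriveD //; apply: diff_derivable; [exact: f1|exact: g1].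
Qed.

Lemma Ck_sum V W k (A : set V) (I : Type) (s : seq I) (F : I -> V -> W) :
  open A -> (forall j, Ck k A (F j)) -> Ck k A (fun x => \sum_(j <- s) F j x).
Proof.
move=> oA H; elim: s => [|j s IH].
  by under eq_fun do rewrite big_nil; exact: Ck_cst.
by under eq_fun do rewrite big_cons; exact: Ck_add.
Qed.

(** Scaling is a continuous bilinear map [R^o * W -> W]; the product rule is the chain rule for this
    map composed with [y |-> (f y, g y)]. *)
Lemma is_diff_scale V W (f df : V -> R^o) (g dg : V -> W) (x : V) :
  is_diff x f df -> is_diff x g dg ->
  is_diff x (fun y => f y *: g y) (fun v => f x *: dg v + df v *: g x).
Proof.
move=> Hf Hg.
have bil : bilinear_for (GRing.Scale.Law.clone _ _ *:%R _)
    (GRing.Scale.Law.clone _ _ *:%R _) (fun (a : R^o) (w : W) => a *: w).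
  split=> [u'|u] a b c /=; first by rewrite scalerDl scalerA.
  by rewrite scalerDr !scalerA mulrC.
pose bM := bilinear_isBilinear.Build R R^o W W _ _
  (fun (a : R^o) (w : W) => a *: w) bil.
pose b : {bilinear R^o -> W -> W} := HB.pack (fun (a : R^o) (w : W) => a *: w) bM.
have cb : continuous (fun p : R^o * W => b p.1 p.2) by exact: scale_continuous.
have Hb p : is_diff p (fun q : R^o * W => b q.1 q.2)
    (fun q => b p.1 q.2 + b q.1 p.2).
  by apply: DiffDef; [exact: differentiable_bilin|rewrite diff_bilin].
exact: (@is_diff_comp _ _ _ _ (fun y => (f y, g y)) _ _ _ x _ (Hb (f x, g x))).
Qed.

Lemma Ck_scale V W k (A : set V) (f : V -> R^o) (g : V -> W) :
  open A -> Ck k A f -> Ck k A g -> Ck k A (fun x => f x *: g x).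
Proof.
move=> oA; elim: k f g => [|k IH] f g.
  by move=> /= Hf Hg x Ax; apply: cvgZ; [exact: Hf|exact: Hg].
move=> Hf Hg; have [f1 f2] := Hf; have [g1 g2] := Hg.
have D x : A x -> is_diff x (fun y => f y *: g y)
    (fun v => f x *: 'd g x v + ('d f x v : R) *: g x).
  by move=> Ax; apply: is_diff_scale; apply: differentiableP; auto.
split=> [x /D//|v].
apply: (@Ck_eq _ _ _ _ (fun x => f x *: 'D_v g x + 'D_v f x *: g x)) => //.
  move=> x Ax; have [dx dv] := D x Ax.
  by rewrite [RHS]deriveE // dv !deriveE //; auto.
apply: Ck_add => //.
  by apply: IH; [exact: CkW|exact: g2].
by apply: IH; [exact: f2|exact: CkW].
Qed.

(* Expanding along a finite frame e with coordinates l turns the chain rule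
   into a sum of products, to which the induction hypothesis applies. *)
Lemma Ck_comp_frame V E W k (A : set V) (B : set E) (f : V -> E) (g : E -> W)
    (I : Type) (s : seq I) (e : I -> E) (l : I -> {linear E -> R^o}) :
  (forall u, u = \sum_(j <- s) l j u *: e j) -> (forall j, continuous (l j)) ->
  open A -> open B -> (forall x, A x -> B (f x)) ->
  Ck k A f -> Ck k B g -> Ck k A (g \o f).
Proof.
move=> le cl oA oB AB; elim: k g => [|k IH] g.
  move=> /= Hf Hg x Ax; apply: continuous_comp; first exact: Hf.
  exact/Hg/AB.
move=> Hf Hg; have [f1 f2] := Hf; have [g1 g2] := Hg.
have dgx x : A x -> differentiable g (f x) by move=> /AB/g1.
split=> [x Ax|v]; first by apply: differentiable_comp; auto.
apply: (@Ck_eq _ _ _ _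
    (fun x => \sum_(j <- s) l j ('D_v f x) *: 'D_(e j) g (f x))) => // [x Ax|].
  have df := f1 _ Ax; have dg := dgx _ Ax.
  rewrite [RHS]deriveE; last exact: differentiable_comp.
  rewrite diff_comp //= -[X in 'd g _ X]deriveE //.
  rewrite [in RHS](le ('D_v f x)) linear_sum; apply: eq_bigr => j _.
  by rewrite linearZ [in LHS](deriveE _ dg).
apply: Ck_sum => // j; apply: Ck_scale => //.
  exact: (Ck_lin (l := l j) oA (cl j) (f2 v)).
by apply: (IH (fun y => 'D_(e j) g y)); [exact: CkW|exact: g2].
Qed.

(** A named coordinate function, so that it can carry the linear structure required of the
    coordinates [l] in [Ck_comp_frame]. *)
Definition row_coord n (j : 'I_n) (u : 'rV[R]_n) : R^o := u 0 j.

Lemma row_coord_is_linear n (j : 'I_n) : linear (row_coord j).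
Proof. by move=> a u v; rewrite /row_coord !mxE. Qed.

HB.instance Definition _ n (j : 'I_n) :=
  GRing.isLinear.Build _ _ _ _ (row_coord j) (row_coord_is_linear j).

Lemma continuous_row_coord n (j : 'I_n) : continuous (row_coord j).
Proof. exact: coord_continuous. Qed.

Lemma Ck_comp V W n k (A : set V) (B : set 'rV[R]_n) (f : V -> 'rV[R]_n)
    (g : 'rV[R]_n -> W) :
  open A -> open B -> (forall x, A x -> B (f x)) ->
  Ck k A f -> Ck k B g -> Ck k A (g \o f).
Proof.
move=> oA oB AB Hf Hg.
apply: (@Ck_comp_frame _ _ _ k A B f g _ (index_enum 'I_n)
  (fun j => delta_mx 0 j) (fun j => row_coord j)) => //.
  exact: row_sum_delta.
exact: continuous_row_coord.
Qed.

Lemma Ck_comp1 V W k (A : set V) (B : set R^o) (f : V -> R^o) (g : R^o -> W) :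
  open A -> open B -> (forall x, A x -> B (f x)) ->
  Ck k A f -> Ck k B g -> Ck k A (g \o f).
Proof.
move=> oA oB AB Hf Hg.
(* The frame of the line [R^o] is the single vector 1, with the identity as coordinate. *)
apply: (@Ck_comp_frame _ _ _ k A B f g _ [:: tt] (fun=> 1) (fun=> idfun)) => //.
  by move=> u; rewrite big_seq1 /= /GRing.scale /= mulr1.
by move=> _ u; exact: cvg_id.
Qed.

Lemma Ck_coord V n k (A : set V) (f : V -> 'rV[R]_n) j :
  open A -> Ck k A f -> Ck k A (fun x => f x 0 j : R^o).
Proof.
move=> oA; apply: (Ck_lin (l := row_coord j)) => //.
exact: continuous_row_coord.
Qed.

(** In the standard basis the differential is a sum of coordinates of [w] times partial derivatives
    of [F] at [f x]; one order of smoothness of [F] is spent on these. *)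
Lemma Ck_diff V W n k (A : set V) (B : set 'rV[R]_n) (f w : V -> 'rV[R]_n)
    (F : 'rV[R]_n -> W) :
  open A -> open B -> (forall x, A x -> B (f x)) ->
  Ck k A f -> Ck k A w -> Ck k.+1 B F ->
  Ck k A (fun x => 'd F (f x) (w x)).
Proof.
move=> oA oB AB Hf Hw HF; have [F1 F2] := HF.
apply: (@Ck_eq _ _ _ _ (fun x => \sum_j w x 0 j *: 'D_(delta_mx 0 j) F (f x))) => //.
  move=> x Ax; rewrite [in RHS](row_sum_delta (w x)) linear_sum.
  by apply: eq_bigr => j _; rewrite deriveE ?linearZ//; exact/F1/AB.
apply: Ck_sum => // j; apply: Ck_scale => //; first exact: Ck_coord.
exact: (Ck_comp oA oB AB Hf (F2 (delta_mx 0 j))).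
Qed.

End CkCalculus.

(** * Smooth bump functions *)

Section Bump.
Context {R : realType}.

(** The polynomial factor in [1/t] makes this family closed under differentiation; [p = 1] gives the
    classical flat function [exp(-1/t)]. *)
Definition flat (p : {poly R}) (t : R^o) : R^o :=
  if 0 < t then p.[t^-1] * expR (- t^-1) else 0.

(** With [s = 1/t], the bound [s^(j+1) / (j+1)! <= exp s] gives [s^j * exp(-s) <= (j+1)! * t]; this
    is summed over the monomials of [p]. *)
Lemma flat_bound (p : {poly R}) :
  exists C : R, forall t : R, `|flat p t| <= C * `|t|.
Proof.
exists (\sum_(j < size p) `|p`_j| * (j.+1)`!%:R) => t.
rewrite /flat; case: ifP => t0; last first.
  by rewrite normr0 mulr_ge0 // sumr_ge0 // => j _; rewrite mulr_ge0.
rewrite (gtr0_norm t0) normrM (gtr0_norm (expR_gt0 _)) horner_coef.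
apply: (@le_trans _ _ ((\sum_(j < size p) `|p`_j * t^-1 ^+ j|) * expR (- t^-1))).
  by rewrite ler_wpM2r ?expR_ge0 ?ler_norm_sum.
rewrite !mulr_suml; apply: ler_sum => j _.
have s0 : 0 < t^-1 by rewrite invr_gt0.
rewrite normrM -!mulrA ler_wpM2l // normrX (gtr0_norm s0).
rewrite expRN ler_pdivrMr ?expR_gt0 //.
have /(le_trans _) := expR_ge1Dxn j (ltW s0) => H.
have {H} : t^-1 ^+ j.+1 / j.+1`!%:R <= expR t^-1 by apply: H; rewrite lerDr.
rewrite ler_pdivrMr ?ltr0n ?fact_gt0 // => H.
rewrite -(ler_pM2l s0) -exprS (le_trans H) //.
have -> : t^-1 * (j.+1`!%:R * t * expR t^-1) = expR t^-1 * j.+1`!%:R.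
  by field; rewrite gt_eqF.
by [].
Qed.

Lemma is_derive_flat (p : {poly R}) (t : R^o) :
  is_derive t 1 (flat p) (flat ('X^2 * (p - p^`())) t).
Proof.
have [t0|t0|->] := ltgtP t 0.
- rewrite /flat (ltNge 0 t) (ltW t0) /=.
  apply: (@near_eq_is_derive _ _ _ (cst 0)).
  have : \forall z \near t, z < 0 by exact: lt_nbhsl.
  by apply: filterS => z z0; rewrite (ltNge 0 z) (ltW z0).
- apply: (@near_eq_is_derive R R^o R^o (fun z => p.[z^-1] * expR (- z^-1))).
    have : \forall z \near t, 0 < z by exact: lt_nbhsr.
    by apply: filterS => z z0; rewrite /flat z0.
  have tn0 : t != 0 by rewrite gt_eqF.
  have dI : is_derive t 1 (fun z : R => z^-1) (- t ^- 2).
    have [did eid] := is_derive_id t (1 : R).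
    by apply: DeriveDef; [exact: derivableV|rewrite deriveV // eid scaler1].
  have dE : is_derive t^-1 1 (fun s : R => expR (- s)) (- expR (- t^-1)).
    have := @is_derive1_comp R expR (fun s => - s) t^-1 (expR (- t^-1)) (- 1) _ _.
    by rewrite mulrN1; apply.
  have dF := @is_deriveM R R^o (horner p) (fun s : R => expR (- s)) t^-1 1 _ _
    (is_derive_poly p t^-1) dE.
  have -> : flat ('X^2 * (p - p^`())) t =
      (p.[t^-1] *: - expR (- t^-1) + expR (- t^-1) *: p^`().[t^-1]) * - t ^- 2.
    by rewrite /flat t0 !hornerE -exprVn /GRing.scale /=; ring.
  exact: (@is_derive1_comp R _ _ t _ _ dF dI).

- rewrite {2}/flat ltxx.
  (* The difference quotient of [flat p] at 0 is [flat ('X * p)], which is [O(h)] and so tends to 0,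
     the value given by the default branch. *)
  have [C HC] := flat_bound ('X * p).
  suff L : h^-1 *: (flat p (h *: (1 : R^o) + 0) - flat p 0) @[h --> 0^'] --> (0:R^o).
    by apply: DeriveDef; [apply/cvg_ex; exists 0|exact: cvg_lim].
  apply/cvgrPdist_le => e e0; near=> h.
  have h0 : h != 0 by near: h; exact: nbhs_dnbhs_neq.
  rewrite sub0r normrN /GRing.scale /= mulr1 addr0 {2}/flat ltxx subr0.
  have -> : h^-1 * flat p h = flat ('X * p) h.
    by rewrite /flat; case: ifP => _; rewrite ?mulr0 // hornerM hornerX mulrA.
  apply: le_trans (HC h) _; apply: (@le_trans _ _ ((`|C| + 1) * `|h|)).
    by rewrite ler_wpM2r // (le_trans (ler_norm C)) // lerDl.
  have C1 : 0 < `|C| + 1 by rewrite ltr_wpDl.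
  rewrite mulrC -ler_pdivlMr //; near: h.
  by apply: dnbhs0_le; rewrite divr_gt0.
Unshelve. all: by end_near. Qed.

Lemma Ck_flat k (p : {poly R}) (A : set R^o) : open A -> Ck k A (flat p).
Proof.
move=> oA; elim: k p => [|k IH] p.
  move=> x _; apply/differentiable_continuous/derivable1_diffP.
  by apply: ex_derive; exact: is_derive_flat.
have df x : differentiable (flat p) x.
  by apply/derivable1_diffP; apply: ex_derive; exact: is_derive_flat.
split=> // v.
have -> : (fun x => 'D_v (flat p) x) =
    (fun x => cst (v : R^o) x *: flat ('X^2 * (p - p^`())) x).
  apply/funext => x; have [_ <-] := is_derive_flat p x.
  rewrite !deriveE //= -[in LHS](mulr1 v) -[v * 1]/(v *: (1 : R^o)).
  by rewrite linearZ.
by apply: Ck_scale; [|exact: Ck_cst|exact: IH].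
Qed.

Lemma exists_bump n (x0 : 'rV[R]_n) (r : R) : 0 < r ->
  exists b : 'rV[R]_n -> R^o,
    [/\ Cinfty setT b, b x0 = 1 & forall x, b x != 0 -> `|x0 - x| <= r].
Proof.
(* [c] is the value of [flat 1] at [r ^+ 2], the argument reached at the centre; dividing by it
   normalises the bump to 1 there. *)
move=> r0; pose c := expR (- (r ^+ 2)^-1).
have r20 : 0 < r ^+ 2 by rewrite exprn_gt0.
(* The norm of ['rV_n] is the maximum norm, which is not smooth in general; the squared Euclidean
   distance is polynomial and dominates each squared coordinate difference. *)
pose f (x : 'rV[R]_n) : R^o :=
  r ^+ 2 - \sum_j (x 0 j - x0 0 j) ^+ 2.
exists (fun x => cst (c^-1 : R^o) x *: flat 1 (f x)); split.
- move=> k; apply: Ck_scale => //; [exact: openT|exact: Ck_cst|].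
  apply: (@Ck_comp1 _ _ _ _ setT setT f) => //; [exact: openT|exact: openT| |].
    have Cs j : Ck k setT (fun x : 'rV[R]_n => x 0 j - x0 0 j : R^o).
      apply: (@Ck_add _ _ _ _ _ _ (cst (- x0 0 j : R^o))); first exact: openT.
        apply: Ck_coord; [exact: openT|exact: Ck_id].
      exact: Ck_cst.
    apply: (@Ck_eq R 'rV[R]_n R^o k setT (fun x => cst (r ^+ 2 : R^o) x +
      \sum_j cst (-1 : R^o) x *:
        ((x 0 j - x0 0 j : R^o) *: (x 0 j - x0 0 j : R^o))) f).
    + exact: openT.
    + move=> x _; rewrite /f /=; congr (_ + _); rewrite -scaler_sumr scaleN1r.
      by congr (- _); apply: eq_bigr => j _; rewrite expr2.
    + apply: Ck_add; [exact: openT|exact: Ck_cst|].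
      apply: Ck_sum => [|j]; first exact: openT.
      apply: Ck_scale; [exact: openT|exact: Ck_cst|].
      by apply: Ck_scale; [exact: openT| |].
  by apply: Ck_flat; exact: openT.
- have -> : f x0 = r ^+ 2.
    by rewrite /f big1 ?subr0 // => j _; rewrite subrr expr0n.
  by rewrite /flat r20 hornerC mul1r /GRing.scale /= mulVf // gt_eqF ?expR_gt0.
- move=> x; rewrite scaler_eq0 negb_or => /andP[_].
  rewrite /flat; case: ifP => [|_]; last by rewrite eqxx.
  rewrite /f subr_gt0 => Hf _.
  rewrite [leLHS]/Num.Def.normr /= mx_normrE; apply: bigmax_le; first exact: ltW.
  move=> [a j] _ /=; rewrite !mxE (ord1 a) distrC.
  rewrite -(@ler_sqr _ _ r) ?nnegrE ?normr_ge0 ?(ltW r0) //.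
  rewrite real_normK ?num_real //; apply: le_trans _ (ltW Hf).
  by rewrite (bigD1 j) //= lerDl sumr_ge0 // => l _; rewrite sqr_ge0.
Qed.

End Bump.

(** * Smooth maps between manifolds *)

Section SmoothFunctions.
Context {R : realType}.

Section OneManifold.
Context {n : nat} {M : manifold R n}.
Implicit Types (E : normedModType R) (c : mindex M) (p : M) (U : set M).

Lemma open_chart_image c U :
  open U -> open (cmap (atlas c) @` (dom (atlas c) `&` U)).
Proof.
move=> oU; rewrite openE => _ [x [cx Ux] <-].
have imx : (cmap (atlas c) @` dom (atlas c)) (cmap (atlas c) x) by exists x.
have n1 : nbhs (cmap (atlas c) x) (cmap (atlas c) @` dom (atlas c)).
  by apply: open_nbhs_nbhs; split => //; exact: im_open.
have n2 : nbhs (cmap (atlas c) x) (cinv (atlas c) @^-1` U).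
  apply: (cinv_continuous imx); rewrite cmapK //; exact: open_nbhs_nbhs.
apply: filterS2 n1 n2 => _ [z cz <-] /=; rewrite cmapK // => Uz.
by exists z.
Qed.

Lemma smooth_on_sub E U V (f : M -> E) : V `<=` U -> smooth_on U f -> smooth_on V f.
Proof.
move=> VU sf c k; apply: Ck_sub (sf c k).
by apply: image_subset => x [cx /VU].
Qed.

(** Smoothness of the germ at [p]: neighbourhoods can be shrunk freely, and [smooth_onP] returns to
    [smooth_on]. *)
Definition smooth_at E (f : M -> E) p : Prop :=
  exists U, [/\ open U, U p & smooth_on U f].

Lemma smooth_onP E U (f : M -> E) :
  (forall p, U p -> smooth_at f p) -> smooth_on U f.
Proof.
move=> H c k; apply: Ck_local => _ [p [cp Up] <-].
have [V [oV Vp sV]] := H _ Up.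
by exists (cmap (atlas c) @` (dom (atlas c) `&` V)); [exists p|exact: sV].
Qed.

Lemma smooth_on_at E U (f : M -> E) p :
  open U -> U p -> smooth_on U f -> smooth_at f p.
Proof. by move=> oU Up sU; exists U. Qed.

Lemma smooth_at_near E (f : M -> E) p :
  smooth_at f p -> \forall q \near p, smooth_at f q.
Proof.
move=> [U [oU Up sU]]; apply: filterS (open_nbhs_nbhs (conj oU Up)) => q Uq.
by exists U.
Qed.

Lemma smooth_at_eq E (f g : M -> E) p :
  (\forall q \near p, f q = g q) -> smooth_at f p -> smooth_at g p.
Proof.
rewrite /prop_near1 nbhsE => -[V [oV Vp] fg] [U [oU Up sU]].
exists (U `&` V); split=> // [|c k]; first exact: openI.
apply: (@Ck_eq _ _ _ _ _ (f \o cinv (atlas c))).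
- by apply: open_chart_image; exact: openI.
- by move=> _ [x [cx [_ Vx]] <-] /=; rewrite cmapK // fg.
- by apply: (smooth_on_sub _ sU) => x [].
Qed.

Lemma smooth_at_cst E (a : E) p : smooth_at (fun _ : M => a) p.
Proof. by exists setT; split=> //; [exact: openT|move=> c k; exact: Ck_cst]. Qed.

Lemma smooth_at2 E E' (f : M -> E) (g : M -> E') p :
  smooth_at f p -> smooth_at g p ->
  exists U, [/\ open U, U p, smooth_on U f & smooth_on U g].
Proof.
move=> [U [oU Up sU]] [V [oV Vp sV]]; exists (U `&` V); split=> //.
- exact: openI.
- by apply: smooth_on_sub sU => x [].
- by apply: smooth_on_sub sV => x [].
Qed.

Lemma smooth_atD E (f g : M -> E) p :
  smooth_at f p -> smooth_at g p -> smooth_at (fun q => f q + g q) p.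
Proof.
move=> sf sg; have [U [oU Up sfU sgU]] := smooth_at2 sf sg.
exists U; split=> // c k.
exact: (@Ck_add _ _ _ k _ (f \o _) (g \o _) (open_chart_image oU) (sfU c k)
  (sgU c k)).
Qed.

Lemma smooth_atZ E (f : M -> R^o) (g : M -> E) p :
  smooth_at f p -> smooth_at g p -> smooth_at (fun q => f q *: g q) p.
Proof.
move=> sf sg; have [U [oU Up sfU sgU]] := smooth_at2 sf sg.
exists U; split=> // c k.
exact: (@Ck_scale _ _ _ k _ (f \o _) (g \o _) (open_chart_image oU) (sfU c k)
  (sgU c k)).
Qed.

Lemma smooth_at_sum E (I : Type) (s : seq I) (F : I -> M -> E) p :
  (forall j, smooth_at (F j) p) -> smooth_at (fun q => \sum_(j <- s) F j q) p.
Proof.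
move=> sF; elim: s => [|j s IH].
  by under eq_fun do rewrite big_nil; exact: smooth_at_cst.
by under eq_fun do rewrite big_cons; exact: smooth_atD.
Qed.

Lemma smooth_at_coord l (f : M -> 'rV[R]_l) p (j : 'I_l) :
  smooth_at f p -> smooth_at (fun q => f q 0 j : R^o) p.
Proof.
move=> [U [oU Up sU]]; exists U; split=> // c k.
exact: (@Ck_coord _ _ _ k _ (f \o _) j (open_chart_image oU) (sU c k)).
Qed.

Lemma smooth_at_Cinfty E l (f : M -> 'rV[R]_l) (b : 'rV[R]_l -> E) p :
  smooth_at f p -> Cinfty setT b -> smooth_at (b \o f) p.
Proof.
move=> [U [oU Up sU]] sb; exists U; split=> // c k.
exact: (@Ck_comp _ _ _ _ k _ setT (f \o _) b (open_chart_image oU) openT _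
  (sU c k) (sb k)).
Qed.

Lemma smooth_at_cmap c p : dom (atlas c) p -> smooth_at (cmap (atlas c)) p.
Proof.
move=> cp; exists (dom (atlas c)); split=> //; first exact: dom_open.
by move=> c'; exact: atlas_smooth.
Qed.

Lemma smooth_at_chart E (f : M -> E) c p : dom (atlas c) p -> smooth_at f p ->
  exists U, [/\ open U, U p, open (cmap (atlas c) @` (dom (atlas c) `&` U)),
    U `<=` dom (atlas c)
    & Cinfty (cmap (atlas c) @` (dom (atlas c) `&` U)) (f \o cinv (atlas c))].
Proof.
move=> cp [U [oU Up sU]]; exists (U `&` dom (atlas c)).
have oV : open (U `&` dom (atlas c)) by apply: openI => //; exact: dom_open.
split=> //; [exact: open_chart_image|exact: (smooth_on_sub (@subIsetl _ U _) sU c)].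
Qed.

Lemma smooth_at_differentiable E (f : M -> E) c p :
  dom (atlas c) p -> smooth_at f p ->
  differentiable (f \o cinv (atlas c)) (cmap (atlas c) p).
Proof.
move=> cp [U [oU Up sU]]; have [H _] := sU c 1%N.
by apply: H; exists p.
Qed.

(** Near [cmap (atlas a) p] the expression of [f] in the chart [a] is its expression in [b] composed
    with the transition map, so this is the chain rule. *)
Lemma diff_chart_change E (f : M -> E) (a b : mindex M) p w :
  dom (atlas a) p -> dom (atlas b) p -> smooth_at f p ->
  'd (f \o cinv (atlas b)) (cmap (atlas b) p)
     ('d (cmap (atlas b) \o cinv (atlas a)) (cmap (atlas a) p) w) =
  'd (f \o cinv (atlas a)) (cmap (atlas a) p) w.
Proof.
move=> ap bp sf.
have da : differentiable (cmap (atlas b) \o cinv (atlas a)) (cmap (atlas a) p).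
  by apply: smooth_at_differentiable => //; exact: smooth_at_cmap.
have pE : (cmap (atlas b) \o cinv (atlas a)) (cmap (atlas a) p) = cmap (atlas b) p.
  by rewrite /= cmapK.
have db : differentiable (f \o cinv (atlas b))
    ((cmap (atlas b) \o cinv (atlas a)) (cmap (atlas a) p)).
  by rewrite pE; exact: smooth_at_differentiable.
have nE : \forall y \near cmap (atlas a) p,
    ((f \o cinv (atlas b)) \o (cmap (atlas b) \o cinv (atlas a))) y =
    (f \o cinv (atlas a)) y.
  have oA := @open_chart_image a _ (dom_open (atlas b)).
  have Ap : (cmap (atlas a) @` (dom (atlas a) `&` dom (atlas b))) (cmap (atlas a) p).
    by exists p.
  apply: filterS (open_nbhs_nbhs (conj oA Ap)) => _ [x [ax bx] <-] /=.
  by rewrite !cmapK.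
rewrite -[in X in 'd _ X _ = _]pE.
apply: etrans (near_eq_diff w nE (differentiable_comp da db)).
exact: (esym (congr1 (fun h => h w) (diff_comp da db))).
Qed.

(** [cmap \o cinv] is the identity only on the image of the chart domain, but this image is open and
    contains the point. *)
Lemma diff_chart_id c p w : dom (atlas c) p ->
  'd (cmap (atlas c) \o cinv (atlas c)) (cmap (atlas c) p) w = w.
Proof.
move=> cp.
have nE : \forall y \near cmap (atlas c) p,
    id y = (cmap (atlas c) \o cinv (atlas c)) y.
  have Ap : (cmap (atlas c) @` dom (atlas c)) (cmap (atlas c) p) by exists p.
  apply: filterS (open_nbhs_nbhs (conj (im_open (c:=atlas c)) Ap)) => _ [x cx <-] /=.
  by rewrite cmapK.
have [did eid] := is_diff_id (cmap (atlas c) p).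
by apply: etrans (esym (near_eq_diff w nE did)) _; rewrite eid.
Qed.

Lemma dirder_chart E (f : M -> E) c p v : dom (atlas c) p -> smooth_at f p ->
  dirder f p v = 'd (f \o cinv (atlas c)) (cmap (atlas c) p) (chart_coord c p v).
Proof.
move=> cp sf; exact: (esym (diff_chart_change v (chart_atP p) cp sf)).
Qed.

Lemma chart_coordD c p u v :
  chart_coord c p (u + v) = chart_coord c p u + chart_coord c p v.
Proof. by rewrite /chart_coord /dirder linearD. Qed.

Lemma chart_coordZ c p a v : chart_coord c p (a *: v) = a *: chart_coord c p v.
Proof. by rewrite /chart_coord /dirder linearZ. Qed.

Lemma chart_coord_sum c p (I : Type) (s : seq I) (F : I -> 'rV[R]_n) :
  chart_coord c p (\sum_(j <- s) F j) = \sum_(j <- s) chart_coord c p (F j).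
Proof. by rewrite /chart_coord /dirder linear_sum. Qed.

(** Inverse of [chart_coord c p] for [p] in the domain of [c]; on basis vectors it gives the frame
    [cframe c]. *)
Definition of_chart c p (w : 'rV[R]_n) : 'rV[R]_n :=
  'd (cmap (atlas (chart_at p)) \o cinv (atlas c)) (cmap (atlas c) p) w.

Lemma chart_coordK c p v : dom (atlas c) p -> of_chart c p (chart_coord c p v) = v.
Proof.
move=> cp; have c0p := chart_atP p.
apply: etrans (diff_chart_id v c0p).
exact: (diff_chart_change v c0p cp (smooth_at_cmap c0p)).
Qed.

Lemma chart_coord_of_chart c c' p w : dom (atlas c) p -> dom (atlas c') p ->
  chart_coord c' p (of_chart c p w) =
  'd (cmap (atlas c') \o cinv (atlas c)) (cmap (atlas c) p) w.
Proof.
move=> cp cp'.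
exact: (diff_chart_change w cp (chart_atP p) (smooth_at_cmap cp')).
Qed.

Lemma of_chart_sum c p w : of_chart c p w = \sum_j w 0 j *: cframe c j p.
Proof.
rewrite /of_chart {1}(row_sum_delta w) linear_sum; apply: eq_bigr => j _.
by rewrite linearZ.
Qed.

End OneManifold.
End SmoothFunctions.

(** * Smooth sections along a map of manifolds *)

Section SmoothAlong.
Context {R : realType} {m n : nat} {M : manifold R m} {N : manifold R n}.
Implicit Types (E : normedModType R) (i : M -> N) (c : mindex N) (p : M).

Lemma smooth_map_id : smooth_map (fun p : M => p).
Proof.
split=> [p|c]; first exact: cvg_id.
by apply: smooth_onP => p; exact: smooth_at_cmap.
Qed.

Lemma smooth_at_cmap_map i c p : smooth_map i -> dom (atlas c) (i p) ->
  smooth_at (cmap (atlas c) \o i) p.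
Proof.
move=> [ci si] cp; apply: smooth_on_at (si c) => //.
by move/continuousP: ci; apply; exact: dom_open.
Qed.

(** In charts this is the differential of a fixed smooth map taken at a smoothly moving point on a
    smoothly moving vector, so [Ck_diff] applies after shrinking the neighbourhood. *)
Lemma smooth_at_diff_along E i c p (F : N -> E) (w : M -> 'rV[R]_n) :
  smooth_map i -> dom (atlas c) (i p) -> smooth_at F (i p) -> smooth_at w p ->
  smooth_at (fun q => 'd (F \o cinv (atlas c)) (cmap (atlas c) (i q)) (w q)) p.
Proof.
move=> smi cp /(smooth_at_chart cp)[U [oU Up oimU Uc sF]] sw.
have si := smooth_at_cmap_map smi cp.
have [V [oV Vp sV swV]] := smooth_at2 si sw.
have oW : open (V `&` i @^-1` U).
  by apply: openI => //; have [/continuousP ci _] := smi; exact: ci.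
exists (V `&` i @^-1` U); split=> // b k.
have VW : V `&` i @^-1` U `<=` V by move=> x [].
apply: (@Ck_diff _ _ _ _ k _ (cmap (atlas c) @` (dom (atlas c) `&` U))
  ((cmap (atlas c) \o i) \o cinv (atlas b)) (w \o cinv (atlas b))
  (F \o cinv (atlas c))).
- exact: open_chart_image.
- exact: oimU.
- move=> _ [x [bx [Vx Ux]] <-] /=; rewrite cmapK //.
  by exists (i x) => //; split=> //; exact: Uc.
- exact: (smooth_on_sub VW sV).
- exact: (smooth_on_sub VW swV).
- exact: sF.
Qed.

Lemma smooth_at_comp E i p (F : N -> E) :
  smooth_map i -> smooth_at F (i p) -> smooth_at (F \o i) p.
Proof.
move=> smi sF; have cp := chart_atP (i p); set c := chart_at _ in cp.
have [U [oU Up oimU Uc sFU]] := smooth_at_chart cp sF.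
have [V [oV Vp sV]] := smooth_at_cmap_map smi cp.
have oW : open (V `&` i @^-1` U).
  by apply: openI => //; have [/continuousP ci _] := smi; exact: ci.
have VW : V `&` i @^-1` U `<=` V by move=> x [].
exists (V `&` i @^-1` U); split=> // b k.
apply: (@Ck_eq _ _ _ _ _ ((F \o cinv (atlas c)) \o
  ((cmap (atlas c) \o i) \o cinv (atlas b)))).
- exact: open_chart_image.
- move=> _ [x [bx [Vx Ux]] <-] /=; rewrite !cmapK //; exact: Uc.
- apply: (@Ck_comp _ _ _ _ k _ (cmap (atlas c) @` (dom (atlas c) `&` U))).
  + exact: open_chart_image.
  + exact: oimU.
  + move=> _ [x [bx [Vx Ux]] <-] /=; rewrite cmapK //.
    by exists (i x) => //; split=> //; exact: Uc.
  + exact: (smooth_on_sub VW sV).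
  + exact: sFU.
Qed.

Lemma smooth_alongP i (U : set M) (V : M -> 'rV[R]_n) : smooth_map i -> open U ->
  smooth_along i U V <->
  forall p c, U p -> dom (atlas c) (i p) ->
    smooth_at (fun q => chart_coord c (i q) (V q)) p.
Proof.
move=> [/continuousP ci _] oU; split=> [H p c Up cp|H c].
  apply: smooth_on_at (H c) => //.
  by apply: openI => //; apply: ci; exact: dom_open.
by apply: smooth_onP => p [Up cp]; exact: H.
Qed.

Lemma smooth_alongD i V V' : smooth_map i -> smooth_along i setT V ->
  smooth_along i setT V' -> smooth_along i setT (fun q => V q + V' q).
Proof.
move=> smi /(smooth_alongP _ smi openT) HV /(smooth_alongP _ smi openT) HV'.
apply/(smooth_alongP _ smi openT) => p c _ cp.
under eq_fun do rewrite chart_coordD.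
by apply: smooth_atD; [exact: HV|exact: HV'].
Qed.

Lemma smooth_alongZ i (f : M -> R^o) V : smooth_map i -> smooth_fun f ->
  smooth_along i setT V -> smooth_along i setT (fun q => f q *: V q).
Proof.
move=> smi sf /(smooth_alongP _ smi openT) HV.
apply/(smooth_alongP _ smi openT) => p c _ cp.
under eq_fun do rewrite chart_coordZ.
by apply: smooth_atZ; [exact: smooth_on_at openT _ sf|exact: HV].
Qed.

Lemma smooth_along_sum i (I : Type) (s : seq I) (V : I -> M -> 'rV[R]_n) :
  smooth_map i -> (forall j, smooth_along i setT (V j)) ->
  smooth_along i setT (fun q => \sum_(j <- s) V j q).
Proof.
move=> smi HV; apply/(smooth_alongP _ smi openT) => p c _ cp.
under eq_fun do rewrite chart_coord_sum.
apply: smooth_at_sum => j.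
by have /(smooth_alongP _ smi openT) := HV j; exact.
Qed.

(** [tmap] uses the preferred chart at [i p], which may jump as [p] varies; reading the result in a
    fixed chart [c] removes this dependence. *)
Lemma tmap_chart_coord i c p v : smooth_map i -> dom (atlas c) (i p) ->
  chart_coord c (i p) (tmap i p v) = dirder (cmap (atlas c) \o i) p v.
Proof.
move=> smi cp.
set a := chart_at (i p); set b := chart_at p.
have ap : dom (atlas a) (i p) by exact: chart_atP.
have bp : dom (atlas b) p by exact: chart_atP.
have E1 : ((cmap (atlas a) \o i) \o cinv (atlas b)) (cmap (atlas b) p) =
    cmap (atlas a) (i p) by rewrite /= cmapK.
have da : differentiable ((cmap (atlas a) \o i) \o cinv (atlas b))
    (cmap (atlas b) p).
  exact: (smooth_at_differentiable bp (smooth_at_cmap_map smi ap)).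
have dc : differentiable (cmap (atlas c) \o cinv (atlas a))
    (((cmap (atlas a) \o i) \o cinv (atlas b)) (cmap (atlas b) p)).
  by rewrite E1; exact: (smooth_at_differentiable ap (smooth_at_cmap cp)).
have nE : \forall y \near cmap (atlas b) p,
    ((cmap (atlas c) \o cinv (atlas a)) \o
     ((cmap (atlas a) \o i) \o cinv (atlas b))) y =
    ((cmap (atlas c) \o i) \o cinv (atlas b)) y.
  have oA : open (i @^-1` dom (atlas a)).
    by case: smi => /continuousP ci _; apply: ci; exact: dom_open.
  have Bp : (cmap (atlas b) @` (dom (atlas b) `&` (i @^-1` dom (atlas a))))
    (cmap (atlas b) p) by exists p.
  have oB := @open_chart_image _ _ _ b _ oA.
  apply: filterS (open_nbhs_nbhs (conj oB Bp)) => _ [x [bx ax] <-] /=.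
  by rewrite !cmapK.
apply: etrans (near_eq_diff v nE (differentiable_comp da dc)).
apply: etrans (esym (congr1 (fun h => h v) (diff_comp da dc))).
by rewrite E1.
Qed.

End SmoothAlong.

Section SmoothAlongFields.
Context {R : realType} {m n : nat} {M : manifold R m} {N : manifold R n}.
Implicit Types (i : M -> N) (c : mindex N) (p : M).

(** The preferred chart in [dirder] varies with [q], so near [p] the derivative is rewritten in the
    fixed chart [chart_at p] before smoothness is checked. *)
Lemma smooth_dirder (E : normedModType R) (F : M -> E) (X : vfield M) p :
  smooth_vfield X -> smooth_at F p -> smooth_at (fun q => dirder F q (X q)) p.
Proof.
move=> /(smooth_alongP _ smooth_map_id openT) sX sF.
have cp := chart_atP p; set c := chart_at _ in cp.
apply: (smooth_at_eq (f := fun q => 'd (F \o cinv (atlas c)) (cmap (atlas c) q)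
  (chart_coord c q (X q)))).
  have nc := open_nbhs_nbhs (conj (dom_open (atlas c)) cp).
  apply: filterS2 nc (smooth_at_near sF) => q cq sq.
  exact: (esym (dirder_chart _ cq sq)).
apply: (smooth_at_diff_along (i := fun q : M => q)) => //.
  exact: smooth_map_id.
exact: sX.
Qed.

Lemma smooth_along_tmap i (X : vfield M) : smooth_map i -> smooth_vfield X ->
  smooth_along i setT (fun q => tmap i q (X q)).
Proof.
move=> smi sX; apply/(smooth_alongP _ smi openT) => p c _ cp.
apply: (smooth_at_eq (f := fun q => dirder (cmap (atlas c) \o i) q (X q))).
  have oA : open (i @^-1` dom (atlas c)).
    by case: smi => /continuousP ci _; apply: ci; exact: dom_open.
  apply: filterS (open_nbhs_nbhs (conj oA cp)) => q cq.
  exact: (esym (tmap_chart_coord _ smi cq)).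
by apply: smooth_dirder => //; exact: smooth_at_cmap_map.
Qed.

Lemma smooth_along_vfield i (Z : vfield N) : smooth_map i -> smooth_vfield Z ->
  smooth_along i setT (Z \o i).
Proof.
move=> smi /(smooth_alongP _ smooth_map_id openT) sZ.
apply/(smooth_alongP _ smi openT) => p c _ cp.
exact: (smooth_at_comp (F := fun q => chart_coord c q (Z q)) smi (sZ _ _ _ cp)).
Qed.

(** Near a point, [V] is a combination of the coordinate fields [cframe c a] with smooth
    coefficients, and [phi] is smooth on these by hypothesis. *)
Lemma smooth_along_endo i (phi : N -> 'End('rV[R]_n)) (V : M -> 'rV[R]_n) :
  (forall c (a : 'I_n),
    smooth_along (fun q : N => q) (dom (atlas c)) (fun q => phi q (cframe c a q))) ->
  smooth_map i -> smooth_along i setT V ->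
  smooth_along i setT (fun q => phi (i q) (V q)).
Proof.
move=> sphi smi /(smooth_alongP _ smi openT) sV.
apply/(smooth_alongP _ smi openT) => p c _ cp.
have oA : open (i @^-1` dom (atlas c)).
  by case: smi => /continuousP ci _; apply: ci; exact: dom_open.
apply: (smooth_at_eq (f := fun q => \sum_a (chart_coord c (i q) (V q)) 0 a *:
   chart_coord c (i q) (phi (i q) (cframe c a (i q))))).
  apply: filterS (open_nbhs_nbhs (conj oA cp)) => q cq.
  rewrite -[in RHS](chart_coordK (V q) cq) of_chart_sum linear_sum chart_coord_sum.
  by apply: eq_bigr => a _; rewrite linearZ chart_coordZ.
apply: smooth_at_sum => a; apply: smooth_atZ.
  by apply: smooth_at_coord; exact: sV.
apply: (smooth_at_comp (F := fun q => chart_coord c q (phi q (cframe c a q))) smi).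
have /(smooth_alongP _ smooth_map_id (dom_open (atlas c))) := sphi c a.
exact.
Qed.

End SmoothAlongFields.

(** * Tensoriality of the covariant derivative of phi *)

Section Tensoriality.
Context {R : realType}.

Section Extension.
Context {n : nat} {N : manifold R n}.
Implicit Types (c : mindex N) (q : N).

(** A Euclidean bump supported in a closed ball inside the chart image is transported to the
    manifold and extended by zero. [O] is the complement of the transported ball, and with the chart
    domain it covers [N], so smoothness is checked on two open sets. *)
Lemma exists_manifold_bump c q0 : dom (atlas c) q0 ->
  exists (chi : N -> R^o) (O : set N),
    [/\ smooth_fun chi, chi q0 = 1, open O,
        (forall q, dom (atlas c) q \/ O q) & forall q, O q -> chi q = 0].
Proof.
move=> cq0; pose im := cmap (atlas c) @` dom (atlas c).
have imq0 : im (cmap (atlas c) q0) by exists q0.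
have [r r0 rim] : exists2 r : R, 0 < r &
    forall x, `|cmap (atlas c) q0 - x| <= r -> im x.
  have := open_nbhs_nbhs (conj (@im_open _ _ _ (atlas c)) imq0).
  move=> /nbhs_normP[e /= e0 He]; exists (e / 2); first by rewrite divr_gt0.
  move=> x Hx; apply: He; apply: le_lt_trans Hx _.
  by rewrite ltr_pdivrMr // mulr_natr mulr2n ltrDl.
have [b [sb b1 bsupp]] := exists_bump (cmap (atlas c) q0) r0.
pose K := [set x : 'rV[R]_n | `|cmap (atlas c) q0 - x| <= r].
have cK : compact K.
  apply: bounded_closed_compact.
    exists (`|cmap (atlas c) q0| + r); split; first exact: num_real.
    move=> B HB x Kx; apply: le_trans _ (ltW HB).
    have -> : x = cmap (atlas c) q0 - (cmap (atlas c) q0 - x) by rewrite subKr.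
    by rewrite (le_trans (ler_normB _ _)) // lerD2l.
  have -> : K = closed_ball (cmap (atlas c) q0) r by rewrite closed_ballE.
  exact: closed_ball_closed.
(* The transported ball is compact, hence closed because the manifold is Hausdorff; without this the
   extension by zero could fail to be smooth. *)
have clA : closed (cinv (atlas c) @` K).
  apply: compact_closed; first exact: mhausdorff.
  apply: continuous_compact => //; apply: continuous_in_subspaceT => x.
  by rewrite inE => /rim imx; exact: cinv_continuous.
pose O := ~` (cinv (atlas c) @` K).
have oO : open O by exact: closed_openC.
pose chi q : R^o := if `[< dom (atlas c) q >] then b (cmap (atlas c) q) else 0.
have chiO q : O q -> chi q = 0.
  move=> Oq; rewrite /chi; case: asboolP => // cq.
  apply/eqP/negPn/negP => bq; apply: Oq.
  by exists (cmap (atlas c) q); [exact: bsupp|exact: cmapK].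
have dO q : dom (atlas c) q \/ O q.
  case: (pselect (dom (atlas c) q)) => [|ncq]; [by left|right].
  move=> [x /rim [z cz <-]]; rewrite cmapK // => zq; apply: ncq; by rewrite -zq.
exists chi, O; split=> //.
- apply: smooth_onP => q _; have [cq|Oq] := dO q.
    apply: (smooth_at_eq (f := b \o cmap (atlas c))).
      apply: filterS (open_nbhs_nbhs (conj (@dom_open _ _ _ (atlas c)) cq)) => z cz.
      by rewrite /chi asboolT.
    by apply: smooth_at_Cinfty => //; exact: smooth_at_cmap.
  apply: (smooth_at_eq (f := fun=> 0)); last exact: smooth_at_cst.
  by apply: filterS (open_nbhs_nbhs (conj oO Oq)) => z /chiO.
- by rewrite /chi asboolT.
Qed.

(** The field with constant components [w] in [c], cut off by [chi]: smooth on the domain of [c] by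
    change of chart, and identically zero on [O]. *)
Lemma smooth_bump_field c (chi : N -> R^o) (O : set N) (w : 'rV[R]_n) :
  smooth_fun chi -> open O -> (forall q, dom (atlas c) q \/ O q) ->
  (forall q, O q -> chi q = 0) ->
  smooth_vfield (fun q => chi q *: of_chart c q w).
Proof.
move=> schi oO dO chiO; apply/(smooth_alongP _ smooth_map_id openT) => q c' _ cq'.
have [cq|Oq] := dO q; last first.
  apply: (smooth_at_eq (f := fun=> 0)); last exact: smooth_at_cst.
  apply: filterS (open_nbhs_nbhs (conj oO Oq)) => z /chiO chi0.
  by rewrite chart_coordZ chi0 scale0r.
have oc := open_nbhs_nbhs (conj (@dom_open _ _ _ (atlas c)) cq).
have oc' := open_nbhs_nbhs (conj (@dom_open _ _ _ (atlas c')) cq').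
apply: (smooth_at_eq (f := fun z => chi z *:
    'd (cmap (atlas c') \o cinv (atlas c)) (cmap (atlas c) z) w)).
  apply: filterS2 oc oc' => z cz cz'.
  by rewrite chart_coordZ (chart_coord_of_chart w cz cz').
apply: smooth_atZ; first exact: smooth_on_at openT _ schi.
apply: (smooth_at_diff_along (i := fun q : N => q)) => //.
- exact: smooth_map_id.
- exact: smooth_at_cmap.
- exact: smooth_at_cst.
Qed.

Lemma vfield_extension q (v : 'rV[R]_n) :
  exists2 Z : vfield N, smooth_vfield Z & Z q = v.
Proof.
have cq := chart_atP q.
have [chi [Z0 [schi chi1 oO dO chiO]]] := exists_manifold_bump cq.
exists (fun z => chi z *: of_chart (chart_at q) z (chart_coord (chart_at q) q v)).
  exact: (smooth_bump_field _ schi oO dO chiO).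
by rewrite chi1 scale1r chart_coordK.
Qed.

End Extension.

Context {m n : nat} {M : manifold R m} {N : manifold R n}.
Variables (i : M -> N) (phi : N -> 'End('rV[R]_n))
  (D : vfield M -> (M -> 'rV[R]_n) -> (M -> 'rV[R]_n)).
Hypothesis smi : smooth_map i.
Hypothesis sphi : forall (c : mindex N) (a : 'I_n),
  smooth_along (fun q : N => q) (dom (atlas c)) (fun q => phi q (cframe c a q)).
Hypothesis conD : connection_along i D.

(** The covariant derivative of [phi] in the direction [X], applied to a section [V] along [i]. *)
Definition covd_phi_along (X : vfield M) (V : M -> 'rV[R]_n) : M -> 'rV[R]_n :=
  fun p => D X (fun q => phi (i q) (V q)) p - phi (i p) (D X V p).

Lemma covd_phi_alongD X V V' p : smooth_vfield X ->
  smooth_along i setT V -> smooth_along i setT V' ->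
  covd_phi_along X (fun q => V q + V' q) p =
  covd_phi_along X V p + covd_phi_along X V' p.
Proof.
move=> sX sV sV'; rewrite /covd_phi_along.
rewrite (conn_addr conD) // linearD opprD addrACA; congr (_ + _).
under eq_fun do rewrite linearD.
by rewrite (conn_addr conD) //; exact: smooth_along_endo.
Qed.

(** The two Leibniz terms containing the derivative of [f] cancel because [phi] is linear on each
    tangent space. *)
Lemma covd_phi_alongZ X (f : M -> R^o) V p : smooth_vfield X -> smooth_fun f ->
  smooth_along i setT V ->
  covd_phi_along X (fun q => f q *: V q) p = f p *: covd_phi_along X V p.
Proof.
move=> sX sf sV; rewrite /covd_phi_along.
under eq_fun do rewrite linearZ.
rewrite !(conn_leibniz conD) //; last exact: smooth_along_endo.
by rewrite linearD !linearZ /= opprD addrACA subrr add0r scalerBr.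
Qed.

Lemma smooth_along0 : smooth_along i setT (fun=> 0 : 'rV[R]_n).
Proof.
have <- : (fun q : M => \sum_(j <- [::] : seq void) (0 : 'rV[R]_n)) = fun=> 0.
  by apply/funext => q; rewrite big_nil.
by apply: smooth_along_sum => // -[].
Qed.

Lemma covd_phi_along0 X p : smooth_vfield X -> covd_phi_along X (fun=> 0) p = 0.
Proof.
move=> sX; have := covd_phi_alongD p sX smooth_along0 smooth_along0.
under eq_fun do rewrite addr0.
by move=> /eqP; rewrite addrC -subr_eq subrr eq_sym => /eqP.
Qed.

Lemma covd_phi_along_sum X (I : Type) (s : seq I) (V : I -> M -> 'rV[R]_n) p :
  smooth_vfield X -> (forall j, smooth_along i setT (V j)) ->
  covd_phi_along X (fun q => \sum_(j <- s) V j q) p =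
  \sum_(j <- s) covd_phi_along X (V j) p.
Proof.
move=> sX sV; elim: s => [|j s IH].
  by under eq_fun do rewrite big_nil; rewrite big_nil covd_phi_along0.
under eq_fun do rewrite big_cons.
rewrite big_cons covd_phi_alongD //; first by rewrite IH.
exact: smooth_along_sum.
Qed.

(* Multiplying by the square of a bump function chi with chi (i p) = 1 does not
   change the value at p and makes V a combination of restrictions of global
   fields of N with coefficients vanishing at p. *)
Lemma covd_phi_along_eq0 X V p : smooth_vfield X -> smooth_along i setT V ->
  V p = 0 -> covd_phi_along X V p = 0.
Proof.
move=> sX sV V0; have cq := chart_atP (i p); set c := chart_at (i p) in cq.
have [chi [Z0 [schi chi1 oO dO chiO]]] := exists_manifold_bump cq.
pose Z (a : 'I_n) z := chi z *: of_chart c z (delta_mx 0 a).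
have sZ a : smooth_along i setT (Z a \o i).
  by apply: smooth_along_vfield => //; exact: (smooth_bump_field _ schi oO dO chiO).
have schii : smooth_fun (chi \o i).
  apply: smooth_onP => q _; apply: smooth_at_comp => //.
  exact: smooth_on_at openT _ schi.
(* Of the two factors [chi], one makes the coefficients globally smooth and the other, inside [Z],
   does the same for the frame. *)
pose f (a : 'I_n) q : R^o := chi (i q) *: (chart_coord c (i q) (V q) 0 a : R^o).
have sf a : smooth_fun (f a).
  apply: smooth_onP => q _; have [cq'|Oq] := dO (i q).
    apply: smooth_atZ; first exact: smooth_on_at openT _ schii.
    by apply: smooth_at_coord; move/(smooth_alongP _ smi openT): sV; apply.
  apply: (smooth_at_eq (f := fun=> 0)); last exact: smooth_at_cst.
  have oOi : open (i @^-1` Z0) by case: smi => /continuousP ci _; exact: ci.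
  apply: filterS (open_nbhs_nbhs (conj oOi Oq)) => z /chiO chi0.
  by rewrite /f chi0 scale0r.
have -> : covd_phi_along X V p =
    covd_phi_along X (fun q => chi (i q) *: (chi (i q) *: V q)) p.
  rewrite (@covd_phi_alongZ X (chi \o i)) //; last first.
    exact: (@smooth_alongZ _ _ _ _ _ _ (chi \o i)).
  by rewrite (@covd_phi_alongZ X (chi \o i)) // /= chi1 !scale1r.
have -> : (fun q => chi (i q) *: (chi (i q) *: V q)) =
    (fun q => \sum_a f a q *: (Z a \o i) q).
  apply/funext => q; have [cq'|Oq] := dO (i q); last first.
    by rewrite chiO // scale0r big1 // => a _; rewrite /f chiO // scale0r scale0r.
  rewrite -{1}(chart_coordK (V q) cq') of_chart_sum !scaler_sumr.
  apply: eq_bigr => a _; rewrite /f /Z /= /of_chart -/(cframe c a (i q)).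
  by rewrite !scalerA; congr (_ *: _); rewrite /GRing.scale /=; ring.
rewrite covd_phi_along_sum //; last by move=> a; exact: smooth_alongZ.
rewrite big1 // => a _; rewrite covd_phi_alongZ //.
have cc0 : chart_coord c (i p) 0 = 0 by rewrite /chart_coord /dirder linear0.
by rewrite /f V0 cc0 mxE scaler0 scale0r.
Qed.

Lemma covd_phi_along_local X V V' p : smooth_vfield X ->
  smooth_along i setT V -> smooth_along i setT V' -> V p = V' p ->
  covd_phi_along X V p = covd_phi_along X V' p.
Proof.
move=> sX sV sV' VV'.
(* The difference [V - V'] is formed by scaling with the constant function -1, so that additivity
   and homogeneity apply to it. *)
have sc : smooth_fun (fun _ : M => -1 : R^o).
  by apply: smooth_onP => q _; exact: smooth_at_cst.
have sN := smooth_alongZ smi sc sV'.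
apply/eqP; rewrite -subr_eq0 -scaleN1r.
rewrite -(covd_phi_alongZ (f := fun=> -1) _ sX sc sV').
rewrite -covd_phi_alongD //; apply/eqP/covd_phi_along_eq0 => //.
  exact: smooth_alongD.
by rewrite VV' scaleN1r subrr.
Qed.

End Tensoriality.

(** By tensoriality [V] may be replaced by [Vt \o i]; both terms are then derivatives of
    restrictions of fields of [N], where [D] is given by [nab]. *)
Lemma covd_phi_alongE (R : realType) (m n : nat) (M : manifold R m)
    (N : manifold R n) (i : M -> N) (phi : N -> 'End('rV[R]_n))
    (nab : vfield N -> vfield N -> vfield N)
    (D : vfield M -> (M -> 'rV[R]_n) -> (M -> 'rV[R]_n))
    (X : vfield M) (V : M -> 'rV[R]_n) (Xt Vt : vfield N) (p : M) :
  smooth_map i ->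
  (forall (c : mindex N) (a : 'I_n),
    smooth_along (fun q : N => q) (dom (atlas c)) (fun q => phi q (cframe c a q))) ->
  induced_connection i nab D ->
  smooth_vfield X -> smooth_along i setT V -> smooth_vfield Xt -> smooth_vfield Vt ->
  Xt (i p) = tmap i p (X p) -> Vt (i p) = V p ->
  covd_phi_along i phi D X V p = covd_phi nab phi Xt Vt (i p).
Proof.
move=> smi sphi [conD HD] sX sV sXt sVt XtE VtE.
rewrite (covd_phi_along_local smi sphi conD sX sV (smooth_along_vfield smi sVt)) //.
rewrite /covd_phi_along (HD X Xt Vt p) //.
by rewrite (HD X Xt (fun z => phi z (Vt z)) p) //;
  exact: smooth_along_endo smooth_map_id _.
Qed.

(** * The splitting of the ambient tangent spaces *)

Section LightlikeSplitting.
Context {R : realType} {n : nat}.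
Variable B : 'Hom('rV[R]_n, 'Hom('rV[R]_n, R^o)).
Hypothesis Bsym : forall u v, B u v = B v u.

(** The orthogonal is an intersection of [\dim U] kernels of linear forms, each costing at most one
    dimension. *)
Lemma dim_orthv (U : {vspace 'rV[R]_n}) : (n <= \dim U + \dim (orthv B U))%N.
Proof.
have dimn : \dim {: 'rV[R]_n} = n by rewrite dimvf /dim /= mul1n.
have dimker u : (n <= (\dim (lker (B u))).+1)%N.
  have := limg_ker_dim (B u) fullv; rewrite capfv dimn.
  have : (\dim (limg (B u)) <= 1)%N.
    by rewrite (leq_trans (dimvS (subvf _))) // dimvf.
  by move=> /=; lia.
have : (n <= size (vbasis U) + \dim (\bigcap_(u <- vbasis U) lker (B u)))%N.
  elim: (tval (vbasis U)) => [|u s IH]; first by rewrite big_nil dimn.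
  rewrite big_cons /=; set W := (\bigcap_(_ <- s) _)%VS in IH *.
  have := dimv_sum_cap (lker (B u)) W.
  have : (\dim (lker (B u) + W) <= n)%N.
    by rewrite (leq_trans (dimvS (subvf _))) // dimn.
  have := dimker u; move: IH => /=; lia.
by rewrite size_tuple.
Qed.

(* Pairing with the basis E of the radical recovers the coefficients of an
   element of the span of the dual family L. *)
Lemma lightlike_splitting r (T STP : {vspace 'rV[R]_n}) (E L : 'I_r -> 'rV[R]_n)
    (rad := (T :&: orthv B T)%VS) (ltr := <<[tuple L j | j < r]>>%VS) :
  direct_sum (orthv B T) rad STP -> basis_of rad [tuple E j | j < r] ->
  (forall j k, B (E j) (L k) = (j == k)%:R) ->
  (T :&: (ltr + STP))%VS = 0%VS /\ (T + (ltr + STP))%VS = fullv.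
Proof.
move=> [TE /directv_addP dTE] Eb EL.
have Erad j : E j \in rad.
  have -> : E j = [tuple E j | j < r]`_j by rewrite -tnth_nth tnth_mktuple.
  by apply: (basis_mem Eb); rewrite mem_nth // size_tuple.
have ET j : E j \in T by have := Erad j; rewrite memv_cap => /andP[].
have EO j : E j \in orthv B T by have := Erad j; rewrite memv_cap => /andP[].
have STPO : (STP <= orthv B T)%VS by rewrite TE addvSr.
have pairL (c : 'I_r -> R) j : B (E j) (\sum_k c k *: L k) = c j.
  rewrite linear_sum (bigD1 j) //= linearZ /= EL eqxx big1 ?addr0.
    by rewrite /GRing.scale /= mulr1.
  by move=> k kj; rewrite linearZ /= EL eq_sym (negPf kj) scaler0.
have ltr0 l : l \in ltr -> (forall j, B (E j) l = 0) -> l = 0.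
  move=> lL l0; rewrite (coord_span lL) big1 // => k _.
  have : l = \sum_k coord [tuple L j | j < r] k l *: L k.
    rewrite {1}(coord_span lL); apply: eq_bigr => j _.
    by rewrite -tnth_nth tnth_mktuple.
  move=> lE; have := l0 k; rewrite {1}lE pairL => ->.
  by rewrite scale0r.
have STP0 j t : t \in STP -> B (E j) t = 0.
  by move=> /(subvP STPO)/memv_orthv; apply.
have capLS : (ltr :&: STP)%VS = 0%VS.
  apply/eqP; rewrite -subv0; apply/subvP => l; rewrite memv_cap => /andP[lL lS].
  by rewrite memv0; apply/eqP/ltr0 => // j; exact: STP0.
(* Write an element of the intersection as [l + t]. The radical is orthogonal to [T] and to [STP],
   so [l] pairs to zero with every [E j] and vanishes; what remains lies in [T] and in [STP], hence
   in the radical and in its complement. *)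
have cap0 : (T :&: (ltr + STP))%VS = 0%VS.
  apply/eqP; rewrite -subv0; apply/subvP => u; rewrite memv_cap => /andP[uT].
  move=> /memv_addP[l lL [t tS uE]]; rewrite memv0; apply/eqP.
  have l0 : l = 0.
    apply: ltr0 => // j; have : B (E j) u = 0.
      by rewrite Bsym; move/memv_orthv: (EO j); apply.
    by rewrite uE linearD /= (STP0 _ _ tS) addr0.
  have ut : u = t by rewrite uE l0 add0r.
  have : u \in (rad :&: STP)%VS by rewrite !memv_cap uT ut tS (subvP STPO).
  by rewrite dTE memv0 => /eqP.
split=> //.
have dimL : \dim ltr = r.
  have /eqP -> : free [tuple L j | j < r]; last by rewrite size_tuple.
  apply/freeP => c c0 k; have := pairL c k.
  rewrite (_ : \sum_k c k *: L k = 0) ?linear0 //.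
  by rewrite -[RHS]c0; apply: eq_bigr => j _; rewrite -tnth_nth tnth_mktuple.
have dimR : \dim rad = r
  by rewrite -(span_basis Eb) (eqP (basis_free Eb)) size_tuple.
(* Dimension count: [ltr] and the radical both have dimension [r], so [ltr + STP] has the dimension
   of the orthogonal of [T], and [dim_orthv] gives at least [n] in total. *)
apply/eqP; rewrite eqEdim subvf /= dimvf /dim /= mul1n.
rewrite (dimv_disjoint_sum cap0) (dimv_disjoint_sum capLS) dimL.
have := dim_orthv T; rewrite TE (dimv_disjoint_sum dTE) dimR.
by [].
Qed.

End LightlikeSplitting.

(** * Bundle relations on a co-screen QGCR-lightlike submanifold *)

Section Decomposition.
Context {R : realType} {m n : nat} {M : manifold R m} {N : manifold R n}.
Variables (i : M -> N) (phi : N -> 'End('rV[R]_n)) (xi : vfield N)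
  (eta : N -> 'Hom('rV[R]_n, R^o)) (g : tensor2 N)
  (r : nat) (STM STP ltr D1 D2 D0 Db S L G : M -> {vspace 'rV[R]_n}).
Hypothesis (Hacm : almost_contact_metric phi xi eta g)
  (Hll : lightlike_submanifold i g r STM STP ltr)
  (Hqgcr : proper_QGCR i g phi STM STP ltr D1 D2 D0 Db S L)
  (Hcs : co_screen i g phi xi STP ltr Db S L G).

Lemma tspace_tr p : (tspace i p :&: tr STP ltr p)%VS = 0%VS /\
  (tspace i p + tr STP ltr p)%VS = fullv.
Proof.
have [U [E [LL [_ Up _ /(_ p Up)]]]] := ll_ltr Hll p.
move=> [Eb ltrE _ EL _]; rewrite /tr ltrE.
exact: (lightlike_splitting (Defs.metric_sym (acm_metric Hacm) (i p))
  (ll_STP_compl Hll p) Eb EL).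
Qed.

Lemma Db_tspace p : (Db p <= tspace i p)%VS.
Proof.
have [-> _] := ll_STM_compl Hll p; apply: subv_trans (addvSr _ _).
by rewrite (qgcr_STM Hqgcr); apply: subv_trans (addvSl _ _); exact: addvSr.
Qed.

Lemma phi_Db_tr p u : u \in Db p -> phi (i p) u \in tr STP ltr p.
Proof.
move=> uD; rewrite (cs_tr Hcs); apply: (subvP (addvSl _ _)).
by apply: (subvP (addvSl _ _)); exact: memv_img.
Qed.

Lemma xi_tr p : xi (i p) \in tr STP ltr p.
Proof. exact: (subvP (addvSr _ _) _ (cs_xi Hcs p)). Qed.

(** [eta] is pairing with [xi], which lies in [STP] and so is normal to the submanifold. *)
Lemma eta_tspace p u : u \in tspace i p -> eta (i p) u = 0.
Proof.
move=> uT; rewrite (acm_eta Hacm) (Defs.metric_sym (acm_metric Hacm)).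
have [nE _] := ll_STP_compl Hll p.
have : xi (i p) \in Defs.normal_space i g p.
  by rewrite nE; exact: (subvP (addvSr _ _) _ (cs_xi Hcs p)).
by move/memv_orthv; apply.
Qed.

(** On the three summands of [tr]: [phi] sends [phi d] to [- d] since [eta] vanishes on [Db],
    preserves [G], and kills [xi]. *)
Lemma phi_tr p h : h \in tr STP ltr p ->
  phi (i p) h \in (Db p + tr STP ltr p)%VS.
Proof.
rewrite (cs_tr Hcs) => /memv_addP[_ /memv_addP[_ /memv_imgP[d dD ->] [w wG ->]]].
move=> [_ /vlineP[a ->] ->]; rewrite !linearD linearZ /=.
rewrite (acm_phi_xi Hacm) scaler0 addr0.
rewrite (acm_phi2 Hacm) eta_tspace ?(subvP (Db_tspace p)) // scale0r addr0.
rewrite memv_add ?memvN //.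
apply: (subvP (addvSl _ _)); apply: (subvP (addvSr _ _)).
by rewrite -(cs_phiG Hcs); exact: memv_img.
Qed.

(** Write [u = e + d + f] along the three summands. Directness of the sums is used in turn: [e] lies
    in [Rad] and in [STM], then [d] in [D0] and in [phi D2 + Db], and finally [u = f] in [phi D2]
    and in [Db]. *)
Lemma Dbundle_Db p : (Dbundle i g phi D0 D2 p :&: Db p)%VS = 0%VS.
Proof.
apply/eqP; rewrite -subv0; apply/subvP => u; rewrite memv_cap memv0 => /andP[].
move=> /memv_addP[_ /memv_addP[e eR [d dD0 ->]] [f fD2 uE]] uD.
have [_ /directv_addP dR] := ll_STM_compl Hll p.
have := qgcr_STM_direct Hqgcr p; rewrite !directv_addE /= => /and3P[].
move=> /and3P[_ _ /eqP d2] _ /eqP d3.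
have STME := qgcr_STM Hqgcr p.
have ufd : u - f \in (phiim i phi D2 p + Db p)%VS.
  by rewrite addrC memv_add ?memvN.
have e0 : e = 0.
  have eE : e = (u - f) - d by rewrite uE addrK addrK.
  apply/eqP; rewrite -memv0 -dR memv_cap eR /= STME eE.
  by rewrite memv_add ?memvN.
have d0 : d = 0.
  have dE : d = u - f by rewrite uE e0 add0r addrK.
  by apply/eqP; rewrite -memv0 -d3 memv_cap dD0 andbT dE.
by rewrite -memv0 -d2 memv_cap uD andbT uE e0 d0 !add0r.
Qed.

Lemma no_component_Db (W : M -> 'rV[R]_n) : (forall p, W p \in Db p) ->
  no_component (Dbundle i g phi D0 D2) Db W.
Proof.
move=> WD p; have := daddv_pi_add (Dbundle_Db p) (subvP (addvSr _ _) _ (WD p)).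
rewrite [X in _ + X]daddv_pi_id ?WD //; last by rewrite capvC Dbundle_Db.
by move/(canRL (addrK _)); rewrite subrr.
Qed.

End Decomposition.

(** * Near auto-parallelism and the shape operators *)

Theorem theorem5p10 (R : realType) (m n r : nat)
  (N : manifold R n) (mu : R)
  (phi : N -> 'End('rV[R]_n)) (xi : vfield N)
  (eta : N -> 'Hom('rV[R]_n, R^o)) (g : tensor2 N)
  (nab : vfield N -> vfield N -> vfield N)
  (M : manifold R m) (i : M -> N)
  (D : vfield M -> (M -> 'rV[R]_n) -> (M -> 'rV[R]_n))
  (STM STP ltr D1 D2 D0 Db S L G : M -> {vspace 'rV[R]_n})
  (Hacm : almost_contact_metric phi xi eta g)
  (Hlc : levi_civita g nab)
  (Hns : nearly_sasakian mu phi xi eta g nab)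
  (Hll : lightlike_submanifold i g r STM STP ltr)
  (HD : induced_connection i nab D)
  (Hqgcr : proper_QGCR i g phi STM STP ltr D1 D2 D0 Db S L)
  (Hcs : co_screen i g phi xi STP ltr Db S L G)
  (Hnap : nearly_auto_parallel i D (tr STP ltr) Db) :
  forall X Y : vfield M, tsection i Db X -> tsection i Db Y ->
  no_component (Dbundle i g phi D0 D2) Db
    (fun p => shape_op i D (tr STP ltr) (varphi1 i phi (tr STP ltr) X) Y p
              + shape_op i D (tr STP ltr) (phi_along i phi Y) X p).
Proof.
move=> X Y [sX XD] [sY YD].
have smi : smooth_map i by have [] := ll_immersion Hll.
have sphi := acm_phi_smooth Hacm.
apply: (no_component_Db Hll Hqgcr) => p.
have [cap0 sumT] := tspace_tr Hacm Hll p.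
(* [phi X] is already transversal for [X] in [Db], so its projection onto [tr] changes nothing. *)
have -> : varphi1 i phi (tr STP ltr) X = phi_along i phi X.
  apply/funext => q; apply: daddv_pi_id; last exact: (phi_Db_tr Hcs).
  by rewrite capvC; have [] := tspace_tr Hacm Hll q.
have trE t : t \in tr STP ltr p ->
    daddv_pi (tspace i p) (tr STP ltr p) t = 0.
  move=> tt; have := daddv_pi_add cap0; rewrite sumT => /(_ t (memvf t)).
  rewrite [X in _ + X]daddv_pi_id // 1?capvC //.
  by move/(canRL (addrK _)); rewrite subrr.
rewrite /shape_op -opprD memvN -linearD /=.
set Q := _ + _.
(* The tangential projection kills [tr] and fixes [Db], so membership of [Q] in [Db + tr]
   suffices. *)
suff /memv_addP[d dD [t tt ->]] : Q \in (Db p + tr STP ltr p)%VS.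
  rewrite linearD /= (trE t tt) addr0 daddv_pi_id //.
  by rewrite (subvP (Db_tspace Hll Hqgcr p)).
pose VX q := tmap i q (X q); pose VY q := tmap i q (Y q).
have sVX : smooth_along i setT VX by exact: smooth_along_tmap.
have sVY : smooth_along i setT VY by exact: smooth_along_tmap.
(* Extensions to [N] that match [X] and [Y] at the single point [i p] are enough, by
   tensoriality. *)
have [Xt sXt XtE] := vfield_extension (i p) (VX p).
have [Yt sYt YtE] := vfield_extension (i p) (VY p).
have covXY := covd_phi_alongE smi sphi HD sX sVY sXt sYt XtE YtE.
have covYX := covd_phi_alongE smi sphi HD sY sVX sYt sXt YtE XtE.
have QE : Q = (covd_phi nab phi Xt Yt (i p) + covd_phi nab phi Yt Xt (i p)) +
    phi (i p) (D X VY p + D Y VX p).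
  by rewrite -covXY -covYX /covd_phi_along linearD addrACA !subrK addrC.
(* With [eta] zero on both fields, only the multiple of [xi] survives on the right of the nearly
   Sasakian identity. *)
have eta0 Z : Z \in Db p -> eta (i p) Z = 0.
  by move=> /(subvP (Db_tspace Hll Hqgcr p)); exact: (eta_tspace Hacm Hll Hcs).
have etaX : eta (i p) (Xt (i p)) = 0 by rewrite XtE eta0 //; exact: XD.
have etaY : eta (i p) (Yt (i p)) = 0 by rewrite YtE eta0 //; exact: YD.
rewrite QE Hns // etaX etaY !scale0r !subr0 memvD //.
  by rewrite !memvZ // (subvP (addvSr _ _)) // (xi_tr Hcs).
have split_add v : v = daddv_pi (tspace i p) (tr STP ltr p) v +
    daddv_pi (tr STP ltr p) (tspace i p) v.
  by rewrite daddv_pi_add // sumT memvf.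
(* After regrouping, the tangential part is the symmetrised [nabla], which lies in [Db] by
   hypothesis and is sent by [phi] into [tr]; the transversal part is handled by [phi_tr]. *)
rewrite (split_add (D X VY p)) (split_add (D Y VX p)) addrACA linearD memvD //.
  rewrite (subvP (addvSr _ _)) // (phi_Db_tr Hcs) //.
  by apply: (Hnap X Y).
by apply: (phi_tr Hacm Hll Hqgcr Hcs); rewrite memvD // memv_pi.
Qed.
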